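(* Let $(q_{n_1},\dots,q_{n_r})$ denote the coordinates of $(\mathbb C^* )^r=\prod_{i\in I^P}\mathbb C^*_q$. The superpotential $\mathcal F_-:(P\backslash G)^\circ\times(\mathbb C^* )^r\to\mathbb C$ is given by the explicit formula $$\mathcal F_-=\sum_{i=1}^{n_1-1}\frac{p_{[i-1]\cup\{i+1\}\cup[n-n_1+i+1,n]}}{p_{[i]\cup[n-n_1+i+1,n]}}+\sum_{j=1}^{r-1}\sum_{i=n_j+1}^{n_{j+1}-1}S_i^{(j)}+\sum_{i=n_r+1}^{n-1}\frac{p_{[i-n_r+1,i+1]\setminus\{i\}}}{p_{[i-n_r+1,i]}}$$ $$\qquad+\sum_{j=1}^r\frac{p_{[n_j-1]\cup\{n_j+1\}}}{p_{[n_j]}}+\sum_{j=1}^rq_{n_j}\frac{p_{\{n-n_{j+1}+1\}\cup[n-n_j+1,n]\setminus\{n-n_{j-1}\}}}{p_{[n-n_j+1,n]}},$$ where $$S_i^{(j)}=\frac{\displaystyle\sum_{J\in\binom{[\min\{i+1,\hat i\}]\setminus\{i\}}{i-n_j}}\epsilon(J)(-1)^{|J|}\,p_{([i-1]\cup\{i+1\})\setminus J}\cdot p_{J\cup[\hat i+1,n]}}{\displaystyle\sum_{J\in\binom{[\min\{i,\hat i\}]}{i-n_j}}(-1)^{|J|}\,p_{[i]\setminus J}\cdot p_{J\cup[\hat i+1,n]}}$$ with $\hat i=n-n_{j+1}+i-n_j$, and $\epsilon(J)=1$ if $i+1\notin J$, $\epsilon(J)=-1$ if $i+1\in J$.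
   Context: Notation. $G=GL_n(\mathbb C)$, $n\ge2$; $B_+,B_-$ are the upper/lower triangular Borel subgroups, $U_+,U_-$ their unipotent radicals, $T$ the diagonal torus. $I=\{1,\dots,n-1\}$, $W=S_n$ generated by $s_i=(i,i+1)$. With $E_{i,j}$ the matrix units, $\dot s_i=\exp(E_{i,i+1})\exp(-E_{i+1,i})\exp(E_{i,i+1})$, and $\dot w=\dot s_{i_1}\cdots\dot s_{i_m}$ for a reduced expression $w=s_{i_1}\cdots s_{i_m}$. Fix $I^P=\{n_1<\dots<n_r\}\subseteq I$ with $r\geq1$, put $n_0=0$, $n_{r+1}=n$, $I_P=I\setminus I^P$. $P\supseteq B_-$ is the parabolic subgroup with $\dot s_i\in P\iff i\in I_P$; $W_P=\langle s_i\mid i\in I_P\rangle$; $w_P,w_0$ are the longest elements of $W_P,W$. $[k,m]=\{k,k+1,\dots,m\}$ (empty if $k>m$), $[m]=[1,m]$; $\binom{S}{k}$ is the set of $k$-element subsets of $S$; $|J|:=\sum_{a\in J}a$. Torus. $\mathcal T^{W_P}=\{t=\mathrm{diag}(t_1,\dots,t_n)\in T\mid t_n=1,\ \dot wt\dot w^{-1}=t\ \forall w\in W_P\}$; it is identified with $\prod_{i\in I^P}\mathbb C^*_q\cong(\mathbb C^* )^r$ via $t\mapsto\mathbf q(t)=(q_{n_1},\dots,q_{n_r})$, $q_{n_j}=t_{n_j}/t_{n_j+1}$. Lie-theoretic superpotential. $Z_P=B_-\cap U_+\mathcal T^{W_P}\dot w_P^{-1}\dot w_0U_+$, and $\mathcal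 F_{\mathrm{Lie}}:Z_P\to\mathbb C$ sends $b_-=u_1t\dot w_P^{-1}\dot w_0u_2$ ($u_1,u_2\in U_+$, $t\in\mathcal T^{W_P}$) to $-\sum_{i=1}^{n-1}\big((u_1)_{i,i+1}+(u_2)_{i,i+1}\big)$; this is well defined. Projected open Richardson variety. $\mathcal R^-_{\mathrm{id},w_0w_P}=(B_-\backslash B_-B_+)\cap(B_-\backslash B_-(w_0w_P)^{-1}B_-)\subset B_-\backslash G$, and $(P\backslash G)^\circ\subset P\backslash G$ is its image under the projection $B_-\backslash G\to P\backslash G$. The superpotential $\mathcal F_-$. Let $\mathcal Z=U_+\dot w_P^{-1}\dot w_0\cap\dot w_P^{-1}\dot w_0U_-\cap B_-B_+$. For $b_-=u_1t\dot w_P^{-1}\dot w_0u_2\in Z_P$ put $\hat b=t^{-1}b_-\in B_-\cap U_+\dot w_P^{-1}\dot w_0U_+$, let $z\in\mathcal Z$ be the unique element with $zB_+=\hat bB_+$, and set $\psi_-(b_-)=(Pz,\mathbf q(t))$. The map $\psi_-:Z_P\to(P\backslash G)^\circ\times\prod_{i\in I^P}\mathbb C^*_q$ is an isomorphism and $\mathcal F_-:=\mathcal F_{\mathrm{Lie}}\circ\psi_-^{-1}$. Plücker coordinates. For $K\subset[n]$ with $|K|=n_j$ elements, $p_K(Pg)$ is the minor of $g$ with rows $1,\dots,n_j$ and columns in $K$ (homogeneous coordinates of the Plücker embedding of $P\backslash G$ into $\prod_j\mathbb P^{\binom n{n_j}-1}$; the formula is homogeneous of degree $0$ in each group of coordinates).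 *)

(* Defs.v *)
From mathcomp Require Import all_boot all_order all_algebra all_fingroup.
From mathcomp Require Export complex.
From mathcomp Require Import boolp classical_sets.
From mathcomp Require Export reals.

Set Implicit Arguments.
Unset Strict Implicit.
Unset Printing Implicit Defensive.

Import GRing.Theory.
Local Open Scope classical_set_scope.
Local Open Scope ring_scope.

(* Indices are 1-based naturals, as in the mathematical text, while matrices
   and finite sets are indexed by 'I_n: the ordinal a : 'I_n stands for the
   integer a.+1. *)

Section Entries.
Variable F : fieldType.

(* (i, j) entry, 1-based; only used for indices in range. *)
Definition ent m n (A : 'M[F]_(m, n)) (i j : nat) : F :=
  if insub i.-1 is Some a then
    if insub j.-1 is Some b then A a b else 0
  else 0.

End Entries.

Section MatrixGroups.
Variables (F : fieldType) (n : nat).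
Implicit Types (A B : set 'M[F]_n) (g : 'M[F]_n).

Definition GL : set 'M[F]_n := [set g | g \in unitmx].
Definition Bminus : set 'M[F]_n := [set g | GL g /\ is_trig_mx g].
Definition Bplus : set 'M[F]_n := [set g | GL g /\ is_trig_mx g^T].
Definition Uminus : set 'M[F]_n := [set g | Bminus g /\ forall i, g i i = 1].
Definition Uplus : set 'M[F]_n := [set g | Bplus g /\ forall i, g i i = 1].
Definition torus : set 'M[F]_n := [set g | GL g /\ is_diag_mx g].

Definition mulset A B : set 'M[F]_n := [set a *m b | a in A & b in B].

Definition subgroup A :=
  [/\ A `<=` GL, A 1%:M, forall a b, A a -> A b -> A (a *m b)
    & forall a, A a -> A (invmx a)].

(* The coset H g, the coset g H, and the image H\A of A in H\G. *)
Definition right_coset A g : set 'M[F]_n := mulset A [set g].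
Definition left_coset g A : set 'M[F]_n := mulset [set g] A.
Definition quotient_by A B : set (set 'M[F]_n) := [set right_coset A g | g in B].

Definition Eunit (i j : nat) : 'M[F]_n :=
  \matrix_(a, b) ((a.+1 == i) && (b.+1 == j))%:R.

(* Exponential of an n x n matrix N with N ^+ n = 0, for which the exponential
   series stops after n terms. *)
Definition expN (N : 'M[F]_n) : 'M[F]_n := \sum_(k < n) (k`!%:R)^-1 *: N ^+ k.

Definition sdot (i : nat) : 'M[F]_n :=
  expN (Eunit i i.+1) *m expN (- Eunit i.+1 i) *m expN (Eunit i i.+1).

End MatrixGroups.

Arguments GL F n : clear implicits.
Arguments Bminus F n : clear implicits.
Arguments Bplus F n : clear implicits.
Arguments Uminus F n : clear implicits.
Arguments Uplus F n : clear implicits.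
Arguments torus F n : clear implicits.
Arguments Eunit F n : clear implicits.
Arguments sdot F n : clear implicits.

Section Weyl.
Variable n : nat.

Definition srefl (i : nat) : 'S_n :=
  if insub i.-1 is Some a then
    if insub i is Some b then tperm a b else 1%g
  else 1%g.

Definition is_word (e : seq nat) : bool := all (fun i => 0 < i < n)%N e.

(* The product of 'S_n composes permutations from left to right. Everything
   below depends on 'S_n only through the Coxeter system ('S_n, {s_i}), so this
   choice does not matter. *)
Definition word_perm (e : seq nat) : 'S_n := (\prod_(i <- e) srefl i)%g.

Definition reduced_expression (w : 'S_n) (e : seq nat) :=
  [/\ is_word e, word_perm e = w
    & forall e', is_word e' -> word_perm e' = w -> (size e <= size e')%N].

Definition redexp (w : 'S_n) : seq nat :=
  xget [::] [set e | reduced_expression w e].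

Definition len (w : 'S_n) : nat := size (redexp w).

Definition longest (W : {set 'S_n}) : 'S_n :=
  [arg max_(w > 1%g in W) len w]%N.

Definition w0 : 'S_n := longest [set: 'S_n].

Definition dotw (F : fieldType) (w : 'S_n) : 'M[F]_n :=
  \prod_(i <- redexp w) sdot F n i.

End Weyl.

(* Below, ns = [:: n_1; ...; n_r] lists the elements of I^P. *)

Definition is_IP (n : nat) (ns : seq nat) : Prop :=
  [/\ sorted ltn ns, all (fun i => 0 < i < n)%N ns & (0 < size ns)%N].

(* n_j for 0 <= j <= r + 1, with n_0 = 0 and n_(r + 1) = n. *)
Definition nn (n : nat) (ns : seq nat) (j : nat) : nat :=
  nth 0%N (0%N :: rcons ns n) j.

Section Parabolic.
Variables (F : fieldType) (n : nat) (ns : seq nat).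

Definition IsubP : seq nat := [seq i <- iota 1 n.-1 | i \notin ns].

Definition WP : {set 'S_n} := <<[set:: [seq srefl n i | i <- IsubP]]>>%g.

Definition wP : 'S_n := longest WP.

(* A subgroup of GL_n containing a Borel subgroup is automatically closed. *)
Definition is_parabolic (P : set 'M[F]_n) :=
  [/\ subgroup P, Bminus F n `<=` P
    & forall i, (0 < i < n)%N -> (P (sdot F n i) <-> i \in IsubP)].

Definition torusWP : set 'M[F]_n :=
  [set t | [/\ torus F n t, ent t n n = 1
    & forall w, w \in WP -> dotw F w *m t *m invmx (dotw F w) = t]].

(* The j-th coordinate, 1 <= j <= r, is q_(n_j) = t_(n_j) / t_(n_j + 1). *)
Definition qcoord (t : 'M[F]_n) : 'rV[F]_(size ns) :=
  \row_(j < size ns)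
    (let m := nn n ns j.+1 in ent t m m / ent t m.+1 m.+1).

Definition wPw0 : 'M[F]_n := invmx (dotw F wP) *m dotw F (w0 n).

Definition ZP : set 'M[F]_n :=
  Bminus F n `&`
  mulset (mulset (mulset (Uplus F n) torusWP) [set wPw0]) (Uplus F n).

(* Some factorisation b = u1 t wPw0 u2, given as (u1, t, u2). *)
Definition factorisation (b : 'M[F]_n) : 'M[F]_n * 'M[F]_n * 'M[F]_n :=
  xget (0, 0, 0)
    [set x | [/\ Uplus F n x.1.1, torusWP x.1.2, Uplus F n x.2
                & b = x.1.1 *m x.1.2 *m wPw0 *m x.2]].

Definition FLie (b : 'M[F]_n) : F :=
  let: (u1, t, u2) := factorisation b in
  - \sum_(1 <= i < n) (ent u1 i i.+1 + ent u2 i i.+1).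

(* (B_- \ B_- B_+) :&: (B_- \ B_- (w_0 w_P)^-1 B_-) *)
Definition Richardson : set (set 'M[F]_n) :=
  quotient_by (Bminus F n) (mulset (Bminus F n) (Bplus F n)) `&`
  quotient_by (Bminus F n)
    (mulset (mulset (Bminus F n) [set dotw F (w0 n * wP)^-1%g]) (Bminus F n)).

(* The projection B_- \ G -> P \ G sends a coset X to P X. *)
Definition PGcirc (P : set 'M[F]_n) : set (set 'M[F]_n) :=
  [set mulset P X | X in Richardson].

Definition Zcal : set 'M[F]_n :=
  mulset (Uplus F n) [set wPw0] `&` mulset [set wPw0] (Uminus F n) `&`
  mulset (Bminus F n) (Bplus F n).

Definition psi_minus (P : set 'M[F]_n) (b : 'M[F]_n) :
    set 'M[F]_n * 'rV[F]_(size ns) :=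
  let: (u1, t, u2) := factorisation b in
  let bhat := invmx t *m b in
  let z := xget 0 [set z | Zcal z /\
                    left_coset z (Bplus F n) = left_coset bhat (Bplus F n)] in
  (right_coset P z, qcoord t).

Definition psi_minus_inv (P : set 'M[F]_n)
    (x : set 'M[F]_n * 'rV[F]_(size ns)) : 'M[F]_n :=
  xget 0 [set b | ZP b /\ psi_minus P b = x].

Definition F_minus (P : set 'M[F]_n)
    (x : set 'M[F]_n * 'rV[F]_(size ns)) : F :=
  FLie (psi_minus_inv P x).

End Parabolic.

Section Plucker.
Local Open Scope set_scope.
Variables (F : fieldType) (n : nat) (ns : seq nat).

(* The subset [k, m] of [n]. *)
Definition segm (k m : nat) : {set 'I_n} :=
  [set a : 'I_n | (k <= a.+1 <= m)%N]%SET.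

Definition sing (k : nat) : {set 'I_n} := segm k k.

Definition sumset (J : {set 'I_n}) : nat := (\sum_(a in J) a.+1)%N.

(* The minor of g with rows 1, ..., #|K| and columns K, in increasing order
   (enum_val enumerates K increasingly). *)
Definition plucker (g : 'M[F]_n) (K : {set 'I_n}) : F :=
  \det (\matrix_(a < #|K|, b < #|K|) ent g a.+1 (enum_val b).+1).

Definition ihat (j i : nat) : nat := (n - nn n ns j.+1 + (i - nn n ns j))%N.

Definition eps_sign (i : nat) (J : {set 'I_n}) : F :=
  if [exists a in J, a.+1 == i.+1] then -1 else 1.

Definition S_num (g : 'M[F]_n) (j i : nat) : F :=
  \sum_(J : {set 'I_n} | (J \subset segm 1 (minn i.+1 (ihat j i)) :\: sing i)
                         && (#|J| == i - nn n ns j)%N)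
    eps_sign i J * (-1) ^+ sumset J
    * plucker g ((segm 1 i.-1 :|: sing i.+1) :\: J)
    * plucker g (J :|: segm (ihat j i).+1 n).

Definition S_den (g : 'M[F]_n) (j i : nat) : F :=
  \sum_(J : {set 'I_n} | (J \subset segm 1 (minn i (ihat j i)))
                         && (#|J| == i - nn n ns j)%N)
    (-1) ^+ sumset J
    * plucker g (segm 1 i :\: J)
    * plucker g (J :|: segm (ihat j i).+1 n).

Definition plucker_formula (g : 'M[F]_n) (q : 'rV[F]_(size ns)) : F :=
  let r := size ns in
  let N := nn n ns in
  let p := plucker g in
  \sum_(1 <= i < N 1%N)
     p (segm 1 i.-1 :|: sing i.+1 :|: segm (n - N 1%N + i.+1) n)
     / p (segm 1 i :|: segm (n - N 1%N + i.+1) n)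
  + \sum_(1 <= j < r) \sum_((N j).+1 <= i < N j.+1) S_num g j i / S_den g j i
  + \sum_((N r).+1 <= i < n)
     p (segm (i - N r).+1 i.+1 :\: sing i) / p (segm (i - N r).+1 i)
  + \sum_(1 <= j < r.+1)
     p (segm 1 (N j).-1 :|: sing (N j).+1) / p (segm 1 (N j))
  + \sum_(1 <= j < r.+1)
     ent q 1 j *
     (p ((sing (n - N j.+1).+1 :|: segm (n - N j).+1 n) :\: sing (n - N j.-1))
      / p (segm (n - N j).+1 n)).

(* None of the denominators of plucker_formula vanishes at g (x / 0 = 0 in
   MathComp, so this has to be said separately). *)
Definition denominators_neq0 (g : 'M[F]_n) : Prop :=
  let r := size ns in
  let N := nn n ns in
  let p := plucker g in
  [/\ forall i, (1 <= i < N 1)%N ->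
        p (segm 1 i :|: segm (n - N 1%N + i.+1) n) != 0,
      forall j i, (1 <= j < r)%N -> (N j < i < N j.+1)%N -> S_den g j i != 0,
      forall i, (N r < i < n)%N -> p (segm (i - N r).+1 i) != 0
    & forall j, (1 <= j <= r)%N ->
        p (segm 1 (N j)) != 0 /\ p (segm (n - N j).+1 n) != 0].

End Plucker.

(* Main.v *)
Require Import Defs.
From mathcomp Require Import all_boot all_order all_algebra all_fingroup.
From mathcomp Require Import complex boolp classical_sets reals.
From mathcomp Require Import zify ring.

(* Write W for the signed permutation matrix w_P^-1 w_0 and let z = u W = W v be
   the representative of a point of (P\G)^o, with u in U_+ and v in U_-. If
   z = bhat c with bhat in B_- and c in U_+, then b = t bhat = (t u t^-1) t W c^-1,
   so F_Lie(b) = sum_i c_{i,i+1} - sum_j q_{n_j} u_{n_j,n_j+1}; any other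
   factorisation u_1 t W u_2 of b gives the same value: it differs by some y
   with y and W y W^-1 in U_+, and conjugation by W matches the nonzero
   superdiagonal entries of y with those of W y W^-1 at places where
   t_i = t_{i+1}.

   The entry c_{i,i+1} is the quotient of the minors of z with rows [i] and
   columns [i-1] U {i+1}, respectively [i]. In block row k the matrix z has
   (-1)^{n_k} times an identity block at the columns hat(a), zeros to the right
   of it and zeros below it. Hence a minor of z on rows ]n_j, i] is, up to a
   common sign, a Plucker coordinate, and the Laplace expansion along the rows
   [n_j] and ]n_j, i] turns the two minors into the numerator and the
   denominator of S_i^(j). *)

Set Implicit Arguments.
Unset Strict Implicit.
Unset Printing Implicit Defensive.

Import GRing.Theory.
Local Open Scope ring_scope.

(** * Minors and the Laplace expansion *)

Section Minors.
Local Open Scope set_scope.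
Variables (F : fieldType) (n : nat).
Implicit Types (h : nat -> 'I_n -> F) (S J : {set 'I_n}) (a b : 'I_n).

(** Two obstacles shape the proof. First, [P] is given only as a subgroup containing the lower Borel
    with a prescribed set of simple reflections, whereas comparing the coordinates of [p *m z] and
    [z] requires [p] to be block lower triangular at every [n_j]. A [p] violating this would put a
    root subgroup across the cut into [P], and commutators would then yield the forbidden [sdot].
    Second, the preimage under psi, the factorisation and the representative [z] are all chosen by
    [xget]: each choice needs an existence proof, and the value has to be computed from whatever was
    chosen. The existence of [z], from a Richardson coset as well as from [bhat], comes from one
    fact: a matrix with nonzero diagonal supported on a partial order has an LU decomposition with
    the same support. Conjugation by W turns the support condition into membership in both [U_+] and
    W [U_-] W^-1. Minors carry natural row numbers and a recursive definition, so that the Laplace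
    expansion along consecutive rows is a plain induction and zero patterns can be used row by
    row. *)

Definition gt_card a S : nat := #|[set b in S | (a < b)%N]|.

(* The minor with rows lo, ..., lo + k - 1 and columns S, expanded along its
   last row; it vanishes unless #|S| = k. *)
Fixpoint minor h lo k S : F :=
  if k is k'.+1 then
    \sum_(a in S) (-1) ^+ gt_card a S * h (lo + k')%N a * minor h lo k' (S :\ a)
  else (S == finset.set0)%:R.

(** Inversions of the list that puts the columns [S] before the columns [J]; their parity is the
    sign of the Laplace term with [J] on the lower rows. *)
Definition inversions J S : nat := (\sum_(a in J) gt_card a S)%N.

Lemma minor_card h lo k S : #|S| != k -> minor h lo k S = 0.
Proof.
elim: k S => [|k IH] S /= cS; first by rewrite -cards_eq0 (negPf cS).
rewrite big1 // => a aS; rewrite IH ?mulr0 //.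
by move: cS; rewrite (cardsD1 a) aS add1n eqSS.
Qed.

Lemma minor_col0 h lo k S a : a \in S ->
  (forall x, (x < k)%N -> h (lo + x)%N a = 0) -> minor h lo k S = 0.
Proof.
elim: k S => [|k IH] S aS h0 /=.
  by case: eqP aS => // ->; rewrite inE.
rewrite big1 // => b bS; have [->|ab] := eqVneq b a.
  by rewrite h0 // mulr0 mul0r.
rewrite (IH (S :\ b)) ?mulr0 ?inE ?aS 1?eq_sym ?ab // => x xk.
by rewrite h0 // ltnW.
Qed.

Lemma minor_last h lo k S a : a \in S ->
  (forall b, b \in S -> b != a -> h (lo + k)%N b = 0) ->
  minor h lo k.+1 S
  = (-1) ^+ gt_card a S * h (lo + k)%N a * minor h lo k (S :\ a).
Proof.
move=> aS h0 /=; rewrite (bigD1 a) //= [X in _ + X]big1 ?addr0 // => b /andP[bS ba].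
by rewrite h0 // mulr0 mul0r.
Qed.

Lemma gt_cardD1 a b S : b \in S ->
  gt_card a S = ((a < b) + gt_card a (S :\ b))%N.
Proof.
move=> bS; rewrite /gt_card (cardsD1 b) !inE bS /=; congr (_ + _)%N.
by apply: eq_card => c; rewrite !inE andbA.
Qed.

Lemma gt_card_split a S J : J \subset S ->
  gt_card a S = (gt_card a (S :\: J) + gt_card a J)%N.
Proof.
move=> JS; rewrite /gt_card -(cardsID J [set b in S | (a < b)%N]) addnC.
congr (_ + _)%N; apply: eq_card => c; rewrite !inE; first by rewrite andbA.
case cJ: (c \in J); rewrite ?andbF ?andbT //=.
by rewrite (fintype.subsetP JS _ cJ).
Qed.

(** Induction on [l]: expansion along the last row turns both sides into sums over pairs of a column
    and a set avoiding it, matched by adjoining the column to the set. *)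
Lemma minor_laplace h lo k l S :
  minor h lo (k + l) S =
  \sum_(J : {set 'I_n} | J \subset S)
     (-1) ^+ inversions J (S :\: J)
     * minor h lo k (S :\: J) * minor h (lo + k)%N l J.
Proof.
elim: l S => [|l IH] S.
  rewrite addn0 (bigD1 finset.set0) ?finset.sub0set //= eqxx mulr1 finset.setD0.
  rewrite /inversions big_set0 expr0 mul1r big1 ?addr0 // => J /andP[_ /negPf->].
  by rewrite mulr0.
rewrite addnS /=.
under eq_bigr => a aS do rewrite IH mulr_sumr.
under [RHS]eq_bigr => J JS do rewrite mulr_sumr.
rewrite (exchange_big_dep (fun a => a \in S)) /=; last first.
  by move=> J a JS; apply/fintype.subsetP: a.
apply: eq_bigr => a aS.
rewrite [RHS](reindex_onto (fun J => a |: J) (fun J => J :\ a)) /=; last first.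
  by move=> J /andP[_ aJ]; rewrite finset.setD1K.
apply: eq_big => J.
  rewrite !inE eqxx /= andbT subsetD1 finset.subUset finset.sub1set aS /=.
  congr (_ && _); apply/idP/eqP => [aJ | <-]; last by rewrite !inE eqxx.
  by rewrite setU1K.
rewrite subsetD1 => /andP[JS aJ].
rewrite setU1K // addnA.
have -> : S :\ a :\: J = S :\: (a |: J).
  by apply/finset.setP => c; rewrite !inE negb_or; do ! case: (_ == _) => //=;
    rewrite andbC.
set T := S :\: (a |: J).
(* The columns of [S] to the right of [a] lie in [T], where they are new inversions, or in [a |: J],
   where they give the last-row sign of the lower minor. *)
have -> : (-1) ^+ gt_card a S = (-1) ^+ gt_card a T * (-1) ^+ gt_card a (a |: J) :> F.
  by rewrite -exprD -gt_card_split // finset.subUset finset.sub1set aS.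
rewrite /inversions (big_setU1 _ aJ) /= exprD.
ring.
Qed.

Lemma minor_split h lo k l S1 S2 : [disjoint S1 & S2] -> #|S1| = k -> #|S2| = l ->
    (forall J, J \subset S1 :|: S2 -> #|J| = l -> J != S2 ->
       minor h lo k ((S1 :|: S2) :\: J) * minor h (lo + k)%N l J = 0) ->
  minor h lo (k + l) (S1 :|: S2) =
  (-1) ^+ inversions S2 S1 * (minor h lo k S1 * minor h (lo + k)%N l S2).
Proof.
move=> dS c1 c2 h0; rewrite minor_laplace (bigD1 S2) ?finset.subsetUr //=.
have -> : (S1 :|: S2) :\: S2 = S1.
  rewrite finset.setDUl finset.setDv finset.setU0; apply/finset.setDidPl => //.
rewrite mulrA [X in _ + X]big1 ?addr0 // => J /andP[JS JS2].
rewrite -mulrA; have [cJ|cJ] := eqVneq #|J| l; first by rewrite h0 ?mulr0.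
by rewrite (minor_card _ _ cJ) !mulr0.
Qed.

(** Any other [J] of size [l] leaves a column of [S2] to the upper rows, where it is zero. *)
Lemma minor_split_upper h lo k l S1 S2 :
    [disjoint S1 & S2] -> #|S1| = k -> #|S2| = l ->
    (forall x a, (x < k)%N -> a \in S2 -> h (lo + x)%N a = 0) ->
  minor h lo (k + l) (S1 :|: S2) =
  (-1) ^+ inversions S2 S1 * (minor h lo k S1 * minor h (lo + k)%N l S2).
Proof.
move=> dS c1 c2 h0; apply: minor_split => // J JS cJ JS2.
have [/fintype.subsetP S2J|/fintype.subsetPn[a aS2 aJ]] := boolP (S2 \subset J).
  case/eqP: JS2; apply/esym/eqP; rewrite eqEcard; apply/andP; split;
    last by rewrite cJ c2.
  exact/fintype.subsetP.
rewrite (@minor_col0 _ _ _ _ a) ?mul0r ?inE ?aJ ?aS2 ?orbT // => x xk.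
exact: h0.
Qed.

(** Any other [J] of size [l] takes a column of [S1] for the lower rows, where it is zero. *)
Lemma minor_split_lower h lo k l S1 S2 :
    [disjoint S1 & S2] -> #|S1| = k -> #|S2| = l ->
    (forall x a, (x < l)%N -> a \in S1 -> h (lo + k + x)%N a = 0) ->
  minor h lo (k + l) (S1 :|: S2) =
  (-1) ^+ inversions S2 S1 * (minor h lo k S1 * minor h (lo + k)%N l S2).
Proof.
move=> dS c1 c2 h0; apply: minor_split => // J JS cJ JS2.
have [JS2'|/fintype.subsetPn[a aJ aS2]] := boolP (J \subset S2).
  by case/eqP: JS2; apply/eqP; rewrite eqEcard JS2' cJ c2 /=.
have aS1 : a \in S1.
  by move/fintype.subsetP/(_ a aJ): JS; rewrite inE (negPf aS2) orbF.
by rewrite (@minor_col0 _ (lo + k)%N _ _ a) ?mulr0 // => x xk; apply: h0.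
Qed.

End Minors.

(** * Minors as determinants; Plucker coordinates of a product *)

Section MinorDet.
Local Open Scope set_scope.
Variables (F : fieldType) (n : nat).
Implicit Types (h : nat -> 'I_n -> F) (S J : {set 'I_n}) (a b : 'I_n).

Lemma sorted_enum_set S : sorted (fun a b => a < b)%N (enum S).
Proof.
rewrite /enum_mem -enumT; apply: sorted_filter.
  by move=> b a c; apply: ltn_trans.
by have := iota_ltn_sorted 0 n; rewrite -val_enum_ord sorted_map.
Qed.

Lemma enum_setD1 S a : enum (S :\ a) = rem a (enum S).
Proof.
rewrite rem_filter ?enum_uniq // /enum_mem -filter_predI.
by apply: eq_filter => b; rewrite !inE.
Qed.

Lemma gt_card_nth S (a0 : 'I_n) (i : nat) : (i < #|S|)%N ->
  gt_card (nth a0 (enum S) i) S = (#|S| - i.+1)%N.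
Proof.
move=> iS; rewrite /gt_card.
have := sorted_enum_set S; rewrite sorted_pairwise; last first.
  by move=> b a c; apply: ltn_trans.
rewrite -{1}(cat_take_drop i (enum S)) (drop_nth a0) -?cardE //.
set x := nth _ _ _; rewrite pairwise_cat allrel_consr pairwise_cons.
move=> /and3P[/andP[t1 _] _ /andP[t2 _]].
have -> : #|[set b in S | (x < b)%N]| = count (fun b : 'I_n => x < b)%N (enum S).
  rewrite cardE /enum_mem -size_filter -filter_predI; congr size.
  by apply: eq_filter => b; rewrite !inE andbC.
rewrite -{1}(cat_take_drop i (enum S)) (drop_nth a0) -?cardE // -/x.
rewrite count_cat /= ltnn add0n.
rewrite (_ : count _ (take _ _) = 0)%N ?add0n; last first.
  apply/eqP; rewrite -leqn0 leqNgt -has_count; apply/hasPn => b.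
  by move/(allP t1) => /= bx; rewrite -leqNgt ltnW.
rewrite (_ : count _ _ = size (drop i.+1 (enum S))); first by rewrite size_drop -cardE.
by apply/eqP; rewrite -all_count.
Qed.

Lemma minor_det h lo k S a0 : #|S| = k ->
  minor h lo k S =
  \det (\matrix_(x < k, y < k) h (lo + x)%N (nth a0 (enum S) y)).
Proof.
elim: k S => [|k IH] S cS.
  by rewrite /= -cards_eq0 cS eqxx det_mx00.
rewrite (expand_det_row _ ord_max) /= -big_enum /= (big_nth a0) -cardE cS big_mkord.
apply: eq_bigr => y _; rewrite mxE /cofactor /= mulrA [h _ _ * _]mulrC.
have yS : (y < size (enum S))%N by rewrite -cardE cS.
rewrite gt_card_nth cS // IH; last first.
  have := mem_nth a0 yS; rewrite mem_enum => yS'.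
  by move: cS; rewrite (cardsD1 (nth a0 (enum S) y)) yS' => -[].
congr (_ * _ * _).
  (* The column at position [y] has [k - y] larger ones, the cofactor exponent is [k + y]: the
     parities agree. *)
  rewrite subSS -signr_odd -[RHS]signr_odd oddD oddB ?oddb //.
  by rewrite -ltnS.
congr (\det _); apply/matrixP => x z; rewrite !mxE /=.
rewrite /bump leqNgt ltn_ord add0n; congr h.
rewrite enum_setD1 remE index_uniq ?enum_uniq // nth_cat size_take yS.
case: ltnP => zy; first by rewrite nth_take.
by rewrite nth_drop; congr nth; lia.
Qed.

Lemma entE m (g : 'M[F]_(m, n)) (a : 'I_m) (b : 'I_n) : ent g a.+1 b.+1 = g a b.
Proof. by rewrite /ent /= !valK. Qed.

Definition rowfun (g : 'M[F]_n) (x : nat) (b : 'I_n) : F := ent g x.+1 b.+1.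

Lemma det_mx0 m (A : 'M[F]_m) : m = 0%N -> \det A = 1.
Proof. by case: m A => // A _; rewrite det_mx00. Qed.

Lemma pluckerE (g : 'M[F]_n) S : plucker g S = minor (rowfun g) 0 #|S| S.
Proof.
have [S0|[a0 _]] := set_0Vmem S.
  by rewrite /plucker det_mx0 S0 ?cards0 //= eqxx.
rewrite (minor_det _ _ a0) //; congr (\det _); apply/matrixP => x y.
by rewrite !mxE (enum_val_nth a0).
Qed.

Lemma sum_ord_trunc m (f : 'I_n -> F) : (m <= n)%N ->
  (forall c : 'I_n, (m <= c)%N -> f c = 0) ->
  \sum_c f c = \sum_(c < m) (if insub (val c) is Some c' then f c' else 0).
Proof.
move=> mn f0; pose f' i := if insub i is Some c then f c else 0.
rewrite [LHS](eq_bigr (f' \o val)); last by move=> c _; rewrite /f' /= valK.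
rewrite [RHS](eq_bigr (f' \o val)) // -(big_mkord xpredT f') -(big_mkord xpredT f').
rewrite (big_cat_nat (leq0n m) mn) //= [X in _ + X]big_nat_cond.
rewrite [X in _ + X]big1; first by rewrite addr0.
by move=> i /andP[/andP[mi lt_in] _]; rewrite /f' insubT //=; apply: f0.
Qed.

(** The first [m] rows of the product are the leading block of [p] times the first [m] rows of [z],
    so all coordinates of size [m] are scaled by the same factor. *)
Lemma plucker_mul_block (p z : 'M[F]_n) m S : #|S| = m ->
  (forall a c : 'I_n, (a < m)%N -> (m <= c)%N -> p a c = 0) ->
  plucker (p *m z) S = plucker p (segm n 1 m) * plucker z S.
Proof.
move=> cS p0.
have mn : (m <= n)%N by rewrite -cS (leq_trans (max_card _)) ?card_ord.
have csm : #|segm n 1 m| = m.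
  rewrite (_ : segm n 1 m = [set widen_ord mn x | x in 'I_m]); last first.
    apply/finset.setP => a; rewrite inE /=; apply/idP/imsetP.
      by move=> am; exists (Ordinal am) => //; apply: val_inj.
    by case=> x _ ->; rewrite /= ltn_ord.
  rewrite card_imset ?card_ord // => x y /(congr1 val) /= xy; exact: val_inj.
have [m0|m_gt0] := posnP m.
  have S0 : S = finset.set0 by apply/eqP; rewrite -cards_eq0 cS m0.
  have S1 : segm n 1 m = finset.set0 by apply/eqP; rewrite -cards_eq0 csm m0.
  rewrite S1 S0 !pluckerE cards0 /= eqxx mulr1 //.
have a0 : 'I_n by exact: (Ordinal (leq_trans m_gt0 mn)).
rewrite !pluckerE csm cS !(minor_det _ _ a0) // -det_mulmx; congr (\det _).
apply/matrixP => x y; rewrite !mxE /rowfun.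
pose x' := widen_ord mn x; have -> : (0 + x = x')%N by [].
rewrite entE mxE (sum_ord_trunc mn); last first.
  by move=> c mc; rewrite p0 ?mul0r /=.
apply: eq_bigr => c _; have cn := leq_trans (ltn_ord c) mn.
rewrite !mxE /= (insubT (fun i => i < n)%N cn) -[x.+1]/(x'.+1) entE; congr (_ * _);
  last by rewrite -[c.+1]/(Ordinal cn).+1 entE.
suff -> : nth a0 (enum (segm n 1 m)) c = Ordinal cn by [].
have -> : enum (segm n 1 m) = [seq widen_ord mn x | x <- enum 'I_m].
  apply: (inj_map val_inj); rewrite -map_comp (eq_map (g := val)) //.
  rewrite val_enum_ord.
  apply: (irr_sorted_eq ltn_trans ltnn); rewrite ?iota_ltn_sorted ?sorted_map //.
    exact: sorted_enum_set.
  move=> i; rewrite mem_iota /= add0n; apply/mapP/idP => [[j] | im].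
    by rewrite mem_enum inE /= => jm ->.
  by exists (Ordinal (leq_trans im mn)); rewrite // mem_enum inE /=.
apply: val_inj; rewrite (nth_map c) ?size_enum_ord //=.
by rewrite nth_enum_ord.
Qed.

End MinorDet.

(** * The signs of the Laplace expansion *)

Section Signs.
Local Open Scope set_scope.
Variables (F : fieldType) (n : nat).
Implicit Types (S J : {set 'I_n}) (a b : 'I_n).

Lemma card_segm k m : (0 < k)%N -> (m <= n)%N -> #|segm n k m| = (m.+1 - k)%N.
Proof.
move=> k0 mn; rewrite cardE -(size_map val).
have -> : [seq val i | i <- enum (segm n k m)] = iota k.-1 (m.+1 - k).
  apply: (irr_sorted_eq ltn_trans ltnn); rewrite ?iota_ltn_sorted ?sorted_map //.
    exact: sorted_enum_set.
  move=> i; rewrite mem_iota; apply/mapP/idP => [[j] | im].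
    by rewrite mem_enum inE /= => jm ->; lia.
  have im' : (i < n)%N by lia.
  by exists (Ordinal im'); rewrite // mem_enum inE /=; lia.
by rewrite size_iota.
Qed.

Lemma sum_gt_card_self J :
  (2 * \sum_(a in J) gt_card a J = #|J| * #|J|.-1)%N.
Proof.
have gtE a : gt_card a J = (\sum_(b in J) (a < b))%N.
  rewrite /gt_card -sum1_card big_mkcond /= [RHS]big_mkcond /=.
  by apply: eq_bigr => b _; rewrite !inE; case: (b \in J); case: ltngtP.
under eq_bigr do rewrite gtE.
rewrite mul2n -addnn {2}exchange_big -big_split /=.
rewrite (eq_bigr (fun=> #|J|.-1)) ?sum_nat_const // => a aJ.
rewrite -big_split (bigD1 a) //= ltnn add0n (cardsD1 a) aJ /= -sum1_card.
apply: eq_big => b; first by rewrite !inE andbC.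
by case/andP => _ ba; case: ltngtP ba => // /val_inj->; rewrite eqxx.
Qed.

(** The inversions of [J] against its complement are those against [S] minus the [l(l-1)/2] pairs
    inside [J]. Adding column numbers makes the former a constant per column, so modulo 2 the sign
    is [(-1)^|J|] up to a factor common to all [J] of size [l]; [e] accounts for one exceptional
    column. *)
Lemma sign_inversions J S (c l : nat) (e : bool) :
    J \subset S -> #|J| = l ->
    (\sum_(a in J) (gt_card a S + a.+1) = c * l + e)%N ->
  (-1) ^+ inversions J (S :\: J) =
  (-1) ^+ (c * l + (l * l.-1)./2) * ((-1) ^+ e * (-1) ^+ sumset J) :> F.
Proof.
move=> JS cJ; rewrite big_split /= => H.
rewrite -exprD -exprD -signr_odd -[RHS]signr_odd; congr (_ ^+ nat_of_bool _).
have T2 := sum_gt_card_self J; rewrite cJ in T2.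
have <- : (\sum_(a in J) gt_card a J = (l * l.-1)./2)%N.
  by rewrite -T2 mul2n doubleK.
move: H; under eq_bigr => a aJ do rewrite (gt_card_split a JS).
rewrite big_split /= -/(sumset J) -/(inversions J (S :\: J)) => H.
have := congr1 odd H; rewrite !oddD; do ! case: (odd _) => //.
Qed.

Lemma gt_card_segm a i : (i <= n)%N -> gt_card a (segm n 1 i) = (i - a.+1)%N.
Proof.
move=> i_n; rewrite /gt_card -[RHS]/(i.+1 - a.+2)%N -card_segm //.
by apply: eq_card => b; rewrite !inE /= ltnS andbC.
Qed.

Lemma sign_segm i J l : (i <= n)%N -> J \subset segm n 1 i -> #|J| = l ->
  (-1) ^+ inversions J (segm n 1 i :\: J) =
  (-1) ^+ (i * l + (l * l.-1)./2) * (-1) ^+ sumset J :> F.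
Proof.
move=> i_n JS cJ.
rewrite (@sign_inversions _ _ i l false JS cJ) ?expr0 ?mul1r //.
rewrite addn0 mulnC -cJ -sum_nat_const; apply: eq_bigr => a aJ.
have := fintype.subsetP JS a aJ; rewrite inE /= => ai.
by rewrite gt_card_segm // subnK.
Qed.

(** Only the column [i+1] deviates from the constant [i], because the gap at [i] lies before it;
    this is the origin of the sign epsilon. *)
Lemma gt_card_skip a i : (0 < i)%N -> (i < n)%N ->
  a \in segm n 1 i.-1 :|: sing n i.+1 ->
  (gt_card a (segm n 1 i.-1 :|: sing n i.+1) + a.+1 = i + (a.+1 == i.+1))%N.
Proof.
move=> i0 i_n; rewrite !inE /= => aS.
pose b := Ordinal i_n.
rewrite (gt_cardD1 a (b := b)); last by rewrite !inE /=; lia.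
have -> : (segm n 1 i.-1 :|: sing n i.+1) :\ b = segm n 1 i.-1.
  by apply/finset.setP => c; rewrite !inE -val_eqE /=; lia.
rewrite gt_card_segm /=; last lia.
by rewrite eqSS; lia.
Qed.

Lemma sign_skip i J l : (0 < i)%N -> (i < n)%N ->
  J \subset segm n 1 i.-1 :|: sing n i.+1 -> #|J| = l ->
  (-1) ^+ inversions J ((segm n 1 i.-1 :|: sing n i.+1) :\: J) =
  (-1) ^+ (i * l + (l * l.-1)./2) * (eps_sign F i J * (-1) ^+ sumset J) :> F.
Proof.
move=> i0 i_n JS cJ; pose e := [exists a in J, a.+1 == i.+1].
rewrite (@sign_inversions _ _ i l e JS cJ).
  by rewrite /eps_sign -/e; case: e; rewrite ?expr1 ?expr0.
rewrite (eq_bigr (fun a : 'I_n => i + (a.+1 == i.+1))%N); last first.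
  by move=> a aJ; apply: gt_card_skip; rewrite // (fintype.subsetP JS).
rewrite big_split /= sum_nat_const cJ mulnC; congr (_ + _)%N.
rewrite /e; case: existsP => [[a /andP[aJ /eqP ai]]|ne].
  rewrite (bigD1 a) //= ai eqxx big1 // => b /andP[_ ba].
  apply/eqP; rewrite eqb0; apply: contra ba => /eqP bi; apply/eqP/val_inj => /=.
  by case: ai bi => -> [].
rewrite big1 // => a aJ; apply/eqP; rewrite eqb0; apply/negP => ai.
by case: ne; exists a; rewrite aJ.
Qed.

End Signs.

(** * Blocks of the composition *)

Section Blocks.
Variables (n : nat) (ns : seq nat).
Hypothesis nsP : is_IP n ns.
Notation N := (nn n ns).
Notation r := (size ns).

Lemma nn_sorted : sorted ltn (0%N :: rcons ns n).
Proof.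
case: nsP => /= s_ns /allP ns_n _; rewrite rcons_path.
case: ns s_ns ns_n nsP => [|m s] /= s_ns ns_n; first by case.
move=> _; rewrite s_ns andbT; apply/andP; split.
  by have /= /andP[] := ns_n m (mem_head _ _).
by have /= /andP[] := ns_n (last m s) (mem_last _ _).
Qed.

Lemma nn_ltn i j : (j <= r.+1)%N -> (i < j)%N -> (N i < N j)%N.
Proof.
move=> jr ij; apply: (sorted_ltn_nth ltn_trans 0%N nn_sorted) => //;
  rewrite inE /= size_rcons; lia.
Qed.

Lemma nn_leq i j : (j <= r.+1)%N -> (i <= j)%N -> (N i <= N j)%N.
Proof.
by move=> jr; rewrite leq_eqVlt => /predU1P[->|/(nn_ltn jr)/ltnW].
Qed.

Lemma nnS_last : N r.+1 = n.
Proof. by rewrite /nn /= nth_rcons ltnn eqxx. Qed.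

Lemma nn_le_n j : (j <= r.+1)%N -> (N j <= n)%N.
Proof. by move=> jr; rewrite -[leqRHS]nnS_last nn_leq. Qed.

Lemma nn_lt_n j : (j <= r)%N -> (N j < n)%N.
Proof. by move=> jr; rewrite -[ltnRHS]nnS_last nn_ltn. Qed.

Lemma mem_nn m : reflect (exists2 j, (0 < j <= r)%N & m = N j) (m \in ns).
Proof.
apply: (iffP (nthP 0%N)) => [[k kr <-]|[[|j] // jr ->]].
  by exists k.+1; rewrite // /nn /= nth_rcons kr.
by case/andP: jr => _ jr; exists j => //; rewrite /nn /= nth_rcons jr.
Qed.

(** The position of the first list entry exceeding [a] is the number of its block, since [nn] is the
    same list with [0] put in front. *)
Definition block_of (a : nat) : nat := find (fun m => a < m)%N (rcons ns n).

Lemma blkP a : (a < n)%N -> (block_of a <= r)%N /\ (N (block_of a) <= a < N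
  (block_of a).+1)%N.
Proof.
move=> an; have ha : has (fun m => a < m)%N (rcons ns n).
  by apply/hasP; exists n; rewrite ?mem_rcons ?mem_head.
split; first by move: ha; rewrite has_find size_rcons ltnS.
apply/andP; split; last exact: (nth_find 0%N ha).
rewrite /block_of; case E: (find _ _) => [|k] //.
have kf : (k < block_of a)%N by rewrite /block_of E.
by rewrite leqNgt; apply/negbT; apply: (before_find 0%N kf).
Qed.

Lemma blk_unique a j : (j <= r)%N -> (N j <= a < N j.+1)%N -> block_of a = j.
Proof.
move=> jr /andP[ja aj].
have an : (a < n)%N by rewrite (leq_trans aj) // nn_le_n.
have [br /andP[ba ab]] := blkP an.
case: (ltngtP (block_of a) j) => // bj.
  by have := @nn_leq (block_of a).+1 j (leqW jr) bj; lia.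
by have := @nn_leq j.+1 (block_of a) (leqW br) bj; lia.
Qed.

(* The 0-based form of the index \hat i of the statement: the column of the
   nonzero entry of wPw0 in row a. *)
Definition pivot_col (a : nat) : nat := (n - N (block_of a).+1 + (a - N (block_of
  a)))%N.

Lemma hatE a j : (j <= r)%N -> (N j <= a < N j.+1)%N ->
  pivot_col a = (n - N j.+1 + (a - N j))%N.
Proof. by move=> jr aj; rewrite /pivot_col (blk_unique jr aj). Qed.

Lemma hat_lt a : (a < n)%N -> (pivot_col a < n)%N.
Proof.
move=> an; have [br /andP[ba ab]] := blkP an.
by have := @nn_le_n (block_of a).+1 br; rewrite /pivot_col; lia.
Qed.

Lemma hat_bounds a j : (j <= r)%N -> (N j <= a < N j.+1)%N ->
  (n - N j.+1 <= pivot_col a < n - N j)%N.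
Proof.
by move=> jr aj; rewrite (hatE jr aj); have := @nn_le_n j.+1 jr; lia.
Qed.

Lemma blk_leq a b : (b < n)%N -> (a <= b)%N -> (block_of a <= block_of b)%N.
Proof.
move=> bn ab; have an := leq_ltn_trans ab bn.
have [bra /andP[ba _]] := blkP an; have [brb /andP[_ bb]] := blkP bn.
rewrite leqNgt; apply/negP => lt.
by have := @nn_leq (block_of b).+1 (block_of a) (leqW bra) lt; lia.
Qed.

(** Going down, the blocks move from right to left, while pivots increase inside a block: [wPw0] is
    block antidiagonal with identity blocks up to sign. *)
Lemma hat_lt_blk a b : (a < n)%N -> (b < n)%N -> (block_of a < block_of b)%N ->
  (pivot_col b < pivot_col a)%N.
Proof.
move=> an bn ab.
have [bra pa] := blkP an; have [brb pb] := blkP bn.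
have /andP[ha _] := hat_bounds bra pa; have /andP[_ hb] := hat_bounds brb pb.
by have := @nn_leq (block_of a).+1 (block_of b) (leqW brb) ab; lia.
Qed.

Lemma hat_inj a b : (a < n)%N -> (b < n)%N -> pivot_col a = pivot_col b -> a = b.
Proof.
move=> an bn hab; case: (ltngtP (block_of a) (block_of b)) => ab.
- by have := hat_lt_blk an bn ab; lia.
- by have := hat_lt_blk bn an ab; lia.
have [bra /andP[pa _]] := blkP an; have [brb /andP[pb _]] := blkP bn.
by move: hab pa pb; rewrite /pivot_col ab; lia.
Qed.

Lemma hat_ltn_blk a b : (a < b)%N -> (b < n)%N -> block_of a = block_of b ->
  (pivot_col a < pivot_col b)%N.
Proof.
move=> ab bn e; have [bra /andP[pa _]] := blkP (ltn_trans ab bn).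
by move: pa; rewrite /pivot_col e; lia.
Qed.

End Blocks.

(** * Plucker coordinates of a normalized matrix *)

Section Evaluation.
Local Open Scope set_scope.
Variables (F : fieldType) (n : nat) (ns : seq nat).
Hypothesis nsP : is_IP n ns.
Notation N := (nn n ns).
Notation r := (size ns).
Notation hat := (pivot_col n ns).
Notation blk := (block_of n ns).
Variable h : nat -> 'I_n -> F.

(** The properties of the rows of [z] used in this section: [h_right] comes from [z = W v],
    [h_below] from [z = u W], and [h_minor] from [z] lying in [B_- B_+]. *)
Hypothesis h_right : forall a (b : 'I_n), (a < n)%N -> (hat a < b)%N -> h a b = 0.
Hypothesis h_hat_row : forall a (b : 'I_n), (a < n)%N -> b = hat a :> nat ->
  h a b = (-1) ^+ N (blk a).
Hypothesis h_below : forall a a' (b : 'I_n),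
  (a < a')%N -> (a' < n)%N -> b = hat a :> nat -> h a' b = 0.
Hypothesis h_minor : forall i, (i <= n)%N -> minor h 0 i (segm n 1 i) != 0.

Let h_hat a (b : 'I_n) : (a < n)%N -> b = hat a :> nat -> h a b != 0.
Proof. by move=> an ba; rewrite h_hat_row // signr_eq0. Qed.

Definition hats lo k : {set 'I_n} :=
  [set b : 'I_n | has (fun a => hat a == b) (iota lo k)].

Lemma hatsP lo k (b : 'I_n) :
  reflect (exists2 a, (lo <= a < lo + k)%N & b = hat a :> nat) (b \in hats lo k).
Proof.
rewrite inE; apply: (iffP hasP) => [[a]|[a ak ba]].
  by rewrite mem_iota => ak /eqP e; exists a.
by exists a; rewrite ?mem_iota ?ba.
Qed.

(** By [h_below] a row vanishes at the pivots of all earlier rows, so after sorting columns by their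
    rows the submatrix is triangular with signs on the diagonal. *)
Lemma minor_hats lo k : (lo + k <= n)%N -> minor h lo k (hats lo k) != 0.
Proof.
elim: k => [|k IH] lkn.
  rewrite /= (_ : hats _ _ = finset.set0) ?eqxx ?oner_eq0 //.
have lkn' : (lo + k < n)%N by rewrite -addnS.
pose b := Ordinal (hat_lt nsP lkn').
have bS : b \in hats lo k.+1 by apply/hatsP; exists (lo + k)%N; rewrite //; lia.
rewrite (@minor_last _ _ _ _ _ _ b) //; last first.
  move=> c /hatsP[a ak ca] cb; apply: (@h_below a) => //.
  rewrite ltn_neqAle; apply/andP; split; last lia.
  by apply: contra cb => /eqP e; rewrite -val_eqE /= ca e.
rewrite !mulf_neq0 ?signr_eq0 ?h_hat //.
rewrite (_ : _ :\ b = hats lo k) ?IH //; first exact: ltnW.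
apply/finset.setP => c; apply/setD1P/hatsP => [[cb /hatsP[a ak ca]]|[a ak ca]].
  exists a => //; have : a != (lo + k)%N by apply: contra cb => /eqP e;
    rewrite -val_eqE /= ca e.
  by move/eqP; lia.
split; last by apply/hatsP; exists a => //; lia.
rewrite -val_eqE /= ca; apply/eqP => /(hat_inj nsP) e.
by suff : a = (lo + k)%N by [lia]; apply: e; lia.
Qed.

Lemma hats_segm j lo k : (j <= r)%N -> (N j <= lo)%N -> (lo + k <= N j.+1)%N ->
  hats lo k = segm n (n - N j.+1 + (lo - N j)).+1 (n - N j.+1 + (lo - N j) + k).
Proof.
move=> jr jlo loj; have Njn := nn_le_n nsP (j := j.+1) jr.
apply/finset.setP => b; rewrite [RHS]inE.
apply/hatsP/idP => [[a ak ->]|bS].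
  by rewrite (hatE nsP jr); lia.
exists (b - (n - N j.+1) + N j)%N; first by lia.
by rewrite (hatE nsP jr); lia.
Qed.

(** Each further block adds the interval of columns immediately to the left of those already
    covered. *)
Lemma hats0_segm j : (j <= r.+1)%N -> hats 0 (N j) = segm n (n - N j).+1 n.
Proof.
elim: j => [|j IH] jr.
  rewrite -[N 0]/0%N subn0.
  by apply/finset.setP => b; rewrite !inE; have /= := ltn_ord b; lia.
have Njn := nn_le_n nsP (j := j.+1) jr.
have ltj := nn_ltn nsP jr (ltnSn j).
have -> : hats 0 (N j.+1) = hats 0 (N j) :|: hats (N j) (N j.+1 - N j).
  apply/finset.setP => b; rewrite !inE -has_cat -{2}[N j]add0n -iotaD subnKC //.
  exact: ltnW.
rewrite (IH (ltnW jr)) (@hats_segm j) //; try lia.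
by apply/finset.setP => b; rewrite !inE; have := ltn_ord b; lia.
Qed.

Lemma inversions_lt (S1 S2 : {set 'I_n}) :
  (forall a b, a \in S2 -> b \in S1 -> (b <= a)%N) -> inversions S2 S1 = 0%N.
Proof.
move=> S12; apply/big1 => a aS2; apply/eqP; rewrite cards_eq0;
  apply/eqP/finset.setP => b.
rewrite !inE; apply/negP => /andP[bS1]; rewrite ltnNge S12 //.
Qed.

Lemma inversions_gt (S1 S2 : {set 'I_n}) :
  (forall a b, a \in S2 -> b \in S1 -> (a < b)%N) ->
  inversions S2 S1 = (#|S2| * #|S1|)%N.
Proof.
move=> S12; rewrite /inversions (eq_bigr (fun=> #|S1|)) ?sum_nat_const // => a aS2.
by apply: eq_card => b; rewrite !inE; case bS1: (b \in S1) => //=; rewrite S12.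
Qed.

(** In the application [g = p *m z] with [p] in the parabolic, and [lam j] is the leading minor of
    [p] of size [N j]. *)
Variables (g : 'M[F]_n) (lam : nat -> F).
Hypothesis g_plucker : forall j (K : {set 'I_n}), (0 < j <= r)%N -> #|K| = N j ->
  plucker g K = lam j * minor h 0 (N j) K.
Hypothesis lam_neq0 : forall j, (0 < j <= r)%N -> lam j != 0.

Definition skip i : {set 'I_n} := segm n 1 i.-1 :|: sing n i.+1.

Lemma card_skip i : (0 < i)%N -> (i < n)%N -> #|skip i| = i.
Proof.
move=> i0 i_n; rewrite /skip cardsU !card_segm //; try lia.
rewrite (_ : _ :&: _ = finset.set0) ?cards0; first by lia.
by apply/finset.setP => b; rewrite !inE; lia.
Qed.

Definition ratio i := minor h 0 i (skip i) / minor h 0 i (segm n 1 i).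

(** Inside the first block the rows before [i] vanish at the pivots of the rows from [i] on. The
    minor therefore splits off a factor independent of [S], which cancels in the quotient. *)
Lemma plucker_block0 i (S : {set 'I_n}) : (i < N 1)%N -> #|S| = i ->
    (forall b, b \in S -> (b <= i)%N) ->
  plucker g (S :|: segm n (n - N 1 + i.+1) n) =
  minor h 0 i S * (lam 1 * minor h i (N 1 - i) (hats i (N 1 - i))).
Proof.
move=> i1 cS Si; have r1 : (0 < r)%N by case: nsP.
have N1n := nn_lt_n nsP r1.
have hE : hats i (N 1 - i) = segm n (n - N 1 + i.+1) n.
  have N0 : N 0 = 0%N by [].
  by rewrite (@hats_segm 0) //; [congr segm; lia | lia].
rewrite (@g_plucker 1) ?r1 //; last first.
  rewrite cardsU card_segm //; last lia.
  rewrite (_ : _ :&: _ = finset.set0) ?cards0 ?cS; first by lia.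
  apply/finset.setP => b; rewrite !inE; apply/negP => /andP[/Si]; lia.
rewrite -{1}(subnKC (ltnW i1)) minor_split_upper ?card_segm //; try lia.
- rewrite inversions_lt ?mul1r ?add0n ?hE; first by rewrite mulrCA mulrC -mulrA.
  by move=> a b; rewrite inE => ? /Si; lia.
- rewrite disjoint_subset; apply/fintype.subsetP => b /Si; rewrite !inE; lia.
move=> x b xi; rewrite -hE => /hatsP[a ak ba].
have an : (a < n)%N by lia.
have b0 c : (c < N 1)%N -> blk c = 0%N by move=> c1; apply: (blk_unique nsP).
by apply: h_right; rewrite ?ba ?hat_ltn_blk //; try lia; rewrite !b0 //; lia.
Qed.

Lemma term_block0 i : (0 < i < N 1)%N ->
  plucker g (segm n 1 i :|: segm n (n - N 1 + i.+1) n) != 0 /\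
  plucker g (segm n 1 i.-1 :|: sing n i.+1 :|: segm n (n - N 1 + i.+1) n)
  / plucker g (segm n 1 i :|: segm n (n - N 1 + i.+1) n) = ratio i.
Proof.
move=> /andP[i0 i1]; have r1 : (0 < r)%N by case: nsP.
have N1n := nn_lt_n nsP r1.
have c0 : lam 1 * minor h i (N 1 - i) (hats i (N 1 - i)) != 0.
  by rewrite mulf_neq0 ?lam_neq0 ?r1 ?minor_hats //; lia.
rewrite !plucker_block0 ?card_skip ?card_segm //; try lia.
- split; first by rewrite mulf_neq0 // h_minor //; lia.
  by rewrite /ratio -mulf_div divff // mulr1.
- by move=> b; rewrite !inE; lia.
by move=> b; rewrite !inE; lia.
Qed.

(** The rows of the last block that precede [i] live in the first [i - N r] columns. These all lie
    to the left of the remaining columns of [S], whence the sign. *)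
Lemma plucker_blockr i (S : {set 'I_n}) : (N r < i < n)%N -> #|S| = i ->
    segm n 1 (i - N r) \subset S ->
  minor h 0 i S * lam r = (-1) ^+ ((i - N r) * N r) *
    (minor h (N r) (i - N r) (hats (N r) (i - N r)) *
     plucker g (S :\: segm n 1 (i - N r))).
Proof.
move=> /andP[ri i_n] cS sS; have r1 : (0 < r)%N by case: nsP.
have Nrn := nn_lt_n nsP (leqnn r).
have hE : hats (N r) (i - N r) = segm n 1 (i - N r).
  rewrite (@hats_segm r) ?nnS_last //; [|lia].
  by rewrite !subnn.
have cD : #|S :\: segm n 1 (i - N r)| = N r.
  rewrite cardsD (finset.setIidPr sS) cS card_segm //; lia.
rewrite (@g_plucker r) ?r1 ?leqnn //.
have {1}-> : S = (S :\: segm n 1 (i - N r)) :|: segm n 1 (i - N r).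
  by rewrite finset.setUC -[in LHS](finset.setID S (segm n 1 (i - N r)))
    (finset.setIidPr sS).
rewrite -{1}(subnKC (ltnW ri)) minor_split_lower ?cD ?card_segm //; try lia.
- rewrite inversions_gt ?cD ?card_segm ?subn1 ?add0n ?hE; try lia.
    by rewrite /=; ring.
  by move=> a b; rewrite !inE; lia.
- rewrite disjoint_sym disjoint_subset; apply/fintype.subsetP => b.
  by rewrite !inE => ->.
move=> x b xi; rewrite add0n !inE => /andP[hb _].
apply: h_right; first by lia.
rewrite (@hatE n ns nsP _ r) ?nnS_last //; lia.
Qed.

Lemma term_blockr i : (N r < i < n)%N ->
  plucker g (segm n (i - N r).+1 i) != 0 /\
  plucker g (segm n (i - N r).+1 i.+1 :\: sing n i)
  / plucker g (segm n (i - N r).+1 i) = ratio i.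
Proof.
move=> ri; have r1 : (0 < r)%N by case: nsP.
have Nr0 : (0 < N r)%N by rewrite -[ltnLHS]/(N 0) (nn_ltn nsP).
have lr : lam r != 0 by rewrite lam_neq0 ?r1 ?leqnn.
have h0 : minor h (N r) (i - N r) (hats (N r) (i - N r)) != 0.
  by rewrite minor_hats //; lia.
have e1 : segm n (i - N r).+1 i = segm n 1 i :\: segm n 1 (i - N r).
  by apply/finset.setP => b; rewrite !inE; lia.
have e2 : segm n (i - N r).+1 i.+1 :\: sing n i = skip i :\: segm n 1 (i - N r).
  by apply/finset.setP => b; rewrite !inE; lia.
have H1 := @plucker_blockr i (segm n 1 i) ri; rewrite -e1 in H1.
have H2 := @plucker_blockr i (skip i) ri; rewrite -e2 in H2.
have {}H1 : minor h 0 i (segm n 1 i) * lam r = (-1) ^+ ((i - N r) * N r) *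
    (minor h (N r) (i - N r) (hats (N r) (i - N r)) * plucker g (segm n (i - N
      r).+1 i)).
  apply: H1; first by rewrite card_segm; lia.
  by apply/fintype.subsetP => b; rewrite !inE; lia.
have {}H2 : minor h 0 i (skip i) * lam r = (-1) ^+ ((i - N r) * N r) *
    (minor h (N r) (i - N r) (hats (N r) (i - N r)) * plucker g (segm n (i - N
      r).+1 i.+1 :\: sing n i)).
  apply: H2; first by rewrite card_skip; lia.
  by apply/fintype.subsetP => b; rewrite !inE; lia.
have h1 : minor h 0 i (segm n 1 i) * lam r != 0 by rewrite mulf_neq0 // h_minor; lia.
split.
  by apply: contraNneq h1 => p0; rewrite H1 p0 !mulr0.
rewrite /ratio -[RHS]mulr1 -(divff lr) mulf_div H1 H2.
by rewrite -!mulf_div !divff ?signr_eq0 // !mul1r.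
Qed.

Lemma term_boundary j : (0 < j <= r)%N ->
  plucker g (segm n 1 (N j)) != 0 /\
  plucker g (segm n 1 (N j).-1 :|: sing n (N j).+1) / plucker g (segm n 1 (N j))
  = ratio (N j).
Proof.
move=> jr; have [j0 jr'] := andP jr.
have Nj0 : (0 < N j)%N by rewrite -[ltnLHS]/(N 0) (nn_ltn nsP) // leqW.
have Njn := nn_lt_n nsP jr'.
rewrite !(@g_plucker j) ?card_skip ?card_segm //; try lia.
split; first by rewrite mulf_neq0 ?lam_neq0 // h_minor // ltnW.
by rewrite /ratio -mulf_div divff ?mul1r // lam_neq0.
Qed.

(** On either column set the last row [N j - 1] has one nonzero candidate, the pivot [c] or its
    substitute [c'], and the cofactors coincide. The sign at [c] cancels against the pivot entry;
    [c'] has all other [N j - 1] columns on its right, which produces the minus sign. *)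
Lemma term_q j (c' : 'I_n) : (0 < j <= r)%N -> c' = (n - N j.+1)%N :> nat ->
  plucker g (segm n (n - N j).+1 n) != 0 /\
  plucker g ((sing n (n - N j.+1).+1 :|: segm n (n - N j).+1 n)
             :\: sing n (n - N j.-1)) / plucker g (segm n (n - N j).+1 n)
  = - ((-1) ^+ N j * h (N j).-1 c').
Proof.
move=> jr c'E; have [j0 jr'] := andP jr.
have jr1 : (j.-1 <= r)%N by lia.
have Nj1 : (N j.-1 < N j)%N by apply: (nn_ltn nsP); lia.
have Nj2 : (N j < N j.+1)%N by apply: (nn_ltn nsP); lia.
have Njn : (N j.+1 <= n)%N by apply: (nn_le_n nsP).
have [m Nm] : exists m, N j = m.+1 by exists (N j).-1; lia.
have mb : (N j.-1 <= m < N j.-1.+1)%N by rewrite prednK //; lia.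
have hm : hat m = (n - N j.-1).-1.
  by rewrite (hatE nsP jr1 mb) prednK //; lia.
have hm_n : (hat m < n)%N by apply: (hat_lt nsP); lia.
pose c := Ordinal hm_n.
have hE : hats 0 (N j) = segm n (n - N j).+1 n by rewrite hats0_segm // leqW.
set K := segm n (n - N j).+1 n in hE *.
set K' := (_ :|: _) :\: _.
have cK : #|K| = N j by rewrite card_segm //; lia.
have K'D : K' = c' |: (K :\ c).
  by apply/finset.setP => b; rewrite !inE -!val_eqE /= hm c'E; lia.
have c'K : c' \notin K :\ c.
  by rewrite !inE c'E; lia.
have cinK : c \in K by rewrite inE /= hm; lia.
have cK' : #|K'| = N j by rewrite K'D cardsU1 c'K; have := cardsD1 c K;
  rewrite cinK cK => ->.
have p0 : plucker g K != 0.
  by rewrite (@g_plucker j) // mulf_neq0 ?lam_neq0 // -hE minor_hats; lia.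
have row0 b : b \in K -> b != c -> h m b = 0.
  rewrite -hE => /hatsP[a aj ba] bc; apply: (@h_below a) => //; last lia.
  rewrite ltn_neqAle; apply/andP; split; last lia.
  by apply: contra bc => /eqP e; rewrite -val_eqE /= ba e.
split => //; move: p0; rewrite !(@g_plucker j) // => p0.
rewrite -mulf_div divff ?lam_neq0 // mul1r; move: p0;
  rewrite mulf_eq0 negb_or => /andP[_].
rewrite Nm (@minor_last _ _ _ _ _ _ c) // ?(@minor_last _ _ _ _ _ K' c') ?K'D
  ?setU1K //; last 2 first.
- by rewrite finset.setU11.
- move=> b /setU1P[-> /eqP //|/setD1P[bc bK] _]; exact: row0.
rewrite -mulrA mulf_eq0 negb_or mulf_eq0 negb_or => /andP[s0 /andP[hc0 m0]].
rewrite add0n mulrA -mulf_div (divff m0) mulr1.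
have -> : h m c = (-1) ^+ N j.-1.
  by rewrite h_hat_row // ?(blk_unique nsP jr1 mb) //; lia.
have -> : gt_card c K = N j.-1.
  transitivity #|segm n c.+2 n|; last by rewrite card_segm //= hm; lia.
  by apply: eq_card => b; rewrite !inE /= hm; have := ltn_ord b; lia.
have -> : gt_card c' (c' |: K :\ c) = m.
  rewrite (@gt_cardD1 _ c' c') ?finset.setU11 // ltnn setU1K // add0n.
  transitivity #|K :\ c|; last by have := cardsD1 c K; rewrite cinK cK Nm => -[].
  apply: eq_card => b; rewrite inE; case bK: (b \in _) => //=.
  by move: bK; rewrite !inE c'E; lia.
by rewrite -expr2 sqrr_sign divr1 exprS mulN1r mulNr opprK.
Qed.

(** The part of the coordinate of size [N j.+1] contributed by the rows outside the range from [N j]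
    to [i - 1]; it does not depend on [J]. *)
Definition mid_coef j i : F :=
  lam j.+1 * ((-1) ^+ ((N j.+1 - N j) * N j) *
    (minor h 0 (N j) (hats 0 (N j)) *
     minor h i (N j.+1 - i) (hats i (N j.+1 - i)))).

Lemma mid_coef_neq0 j i : (j < r)%N -> (N j < i < N j.+1)%N -> mid_coef j i != 0.
Proof.
move=> jr ji; have Njn : (N j.+1 <= n)%N by apply: (nn_le_n nsP); lia.
by rewrite !mulf_neq0 ?signr_eq0 ?lam_neq0 ?minor_hats //; lia.
Qed.

(** Two splittings: the last [N j] columns are pivots of the rows before block [j] and vanish below
    them; then the pivots of the rows from [i] on vanish on the rows of the block before [i]. Only
    the minor on [J] remains variable. *)
Lemma plucker_mid j i (J : {set 'I_n}) : (j < r)%N -> (N j < i < N j.+1)%N ->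
    J \subset segm n 1 (ihat n ns j i) -> #|J| = (i - N j)%N ->
  plucker g (J :|: segm n (ihat n ns j i).+1 n) =
  mid_coef j i * minor h (N j) (i - N j) J.
Proof.
move=> jr ji /fintype.subsetP Jh cJ.
have Njn : (N j.+1 <= n)%N by apply: (nn_le_n nsP); lia.
have hE : hats 0 (N j) = segm n (n - N j).+1 n by rewrite hats0_segm //; lia.
have hC : hats i (N j.+1 - i) = segm n (ihat n ns j i).+1 (n - N j).
  rewrite (@hats_segm j) //; try lia.
  by rewrite /ihat; congr segm; lia.
have Jb b : b \in J -> (b < n - N j.+1 + (i - N j))%N.
  by move/Jh; rewrite inE /ihat.
have cC : #|hats i (N j.+1 - i)| = (N j.+1 - i)%N by rewrite hC card_segm /ihat //; lia.
have JC : [disjoint J & hats i (N j.+1 - i)].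
  rewrite disjoint_subset; apply/fintype.subsetP => b /Jb bJ.
  by rewrite hC !inE /ihat; lia.
have cJC : #|J :|: hats i (N j.+1 - i)| = (N j.+1 - N j)%N.
  by rewrite cardsU (disjoint_setI0 JC) cards0 cJ cC; lia.
have JCb b : b \in J :|: hats i (N j.+1 - i) -> (b < n - N j)%N.
  by rewrite hC inE => /orP[/Jb|]; rewrite ?inE /ihat; lia.
have -> : J :|: segm n (ihat n ns j i).+1 n =
          hats 0 (N j) :|: (J :|: hats i (N j.+1 - i)).
  apply/finset.setP => b; rewrite hE hC !inE.
  by case: (b \in J); rewrite ?orbT // /ihat; have := ltn_ord b; lia.
have cE : #|hats 0 (N j)| = N j by rewrite hE card_segm //; lia.
have dE : [disjoint hats 0 (N j) & J :|: hats i (N j.+1 - i)].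
  rewrite disjoint_sym disjoint_subset; apply/fintype.subsetP => b /JCb.
  by rewrite hE !inE; lia.
rewrite (@g_plucker j.+1) //; last first.
  by rewrite cardsU (disjoint_setI0 dE) cards0 cE cJC; lia.
have {1}-> : N j.+1 = (N j + (N j.+1 - N j))%N by lia.
rewrite minor_split_lower //; last first.
  move=> x b xk /hatsP[a ak ba]; apply: (@h_below a) => //; lia.
rewrite inversions_gt ?cE ?cJC; last first.
  by move=> a b /JCb; rewrite hE inE; lia.
have {2}-> : (N j.+1 - N j = (i - N j) + (N j.+1 - i))%N by lia.
rewrite minor_split_upper //; last first.
  move=> x b xk /hatsP[a ak ba]; apply: h_right; first by lia.
  rewrite ba; apply: hat_ltn_blk; try lia.
  by rewrite !(@blk_unique _ _ nsP _ j) //; lia.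
rewrite inversions_lt; last by move=> a b; rewrite hC inE /ihat => ? /Jb; lia.
rewrite mul1r /mid_coef add0n subnKC; last lia.
by ring.
Qed.

(** The Laplace sum runs over all subsets of [S], but the rows from [N j] to [i - 1] vanish to the
    right of column [ihat]. Discarding the sets that reach beyond it leaves the index range [T],
    which explains the minima in the theorem. *)
Lemma laplace_mid j i (S T : {set 'I_n}) (sg : {set 'I_n} -> F) (e : nat) :
    (0 < j < r)%N -> (N j < i < N j.+1)%N -> #|S| = i ->
    (forall J : {set 'I_n},
       (J \subset T) = (J \subset S) && (J \subset segm n 1 (ihat n ns j i))) ->
    (forall J : {set 'I_n}, J \subset S -> #|J| = (i - N j)%N ->
       (-1) ^+ inversions J (S :\: J) = (-1) ^+ e * sg J) ->
  \sum_(J : {set 'I_n} | (J \subset T) && (#|J| == i - nn n ns j)%N)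
    sg J * plucker g (S :\: J) * plucker g (J :|: segm n (ihat n ns j i).+1 n)
  = minor h 0 i S * ((-1) ^+ e * (lam j * mid_coef j i)).
Proof.
move=> jr ji cS TS sgn.
have -> : minor h 0 i S = minor h 0 (N j + (i - N j)) S by rewrite subnKC //; lia.
rewrite minor_laplace mulr_suml [RHS](bigID (fun J : {set 'I_n} => (J \subset T) &&
  (#|J| == i - N j)%N)) /=.
rewrite [X in _ + X]big1 ?addr0 => [|J /andP[JS]].
  apply: eq_big => J; first by rewrite TS; case: (J \subset S); rewrite ?andbF.
  rewrite TS -andbA => /and3P[JS Jh /eqP cJ].
  rewrite plucker_mid //; try lia.
  rewrite (@g_plucker j) //; first last.
  - by rewrite cardsD (finset.setIidPr JS) cJ cS; lia.
  - by lia.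
  rewrite sgn // add0n.
  rewrite [RHS](_ : _ = (-1) ^+ e * (-1) ^+ e * (sg J * (lam j * minor h 0 (N j) (S
    :\: J)) * (mid_coef j i * minor h (N j) (i - N j) J))); last by ring.
  by rewrite -expr2 sqrr_sign mul1r.
rewrite negb_and TS JS /= => /orP[Jh|cJ]; last first.
  by rewrite [minor h (0 + N j) _ _]minor_card // mulr0 mul0r.
have /fintype.subsetPn[b bJ] := Jh.
rewrite !inE /ihat => bh.
rewrite [minor h (0 + N j) _ _](@minor_col0 _ _ _ _ _ _ b) ?mulr0 ?mul0r // => x xi.
apply: h_right; first by have := @nn_le_n _ _ nsP j.+1; lia.
by rewrite (@hatE _ _ nsP _ j); lia.
Qed.

Lemma term_mid j i : (0 < j < r)%N -> (N j < i < N j.+1)%N ->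
  S_den ns g j i != 0 /\ S_num ns g j i / S_den ns g j i = ratio i.
Proof.
move=> jr ji; have Njn : (N j.+1 < n)%N by apply: (nn_lt_n nsP); lia.
pose l := (i - N j)%N.
(* The exponent [e] is the common sign found in [sign_segm] and [sign_skip]; being the same above
   and below, it cancels. *)
have D : S_den ns g j i = _ := laplace_mid jr ji
  (S := segm n 1 i) (e := (i * l + (l * l.-1)./2)%N) (sg :=
    fun J => (-1) ^+ sumset J) _ _ _.
have Nm : S_num ns g j i = _ := laplace_mid jr ji
  (S := skip i) (e := (i * l + (l * l.-1)./2)%N) (sg :=
    fun J => eps_sign F i J * (-1) ^+ sumset J) _ _ _.
rewrite {}D; first last.
- move=> J JS cJ; apply: sign_segm => //; lia.
- move=> J; rewrite -finset.subsetI.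
  suff -> : segm n 1 (minn i (ihat n ns j i)) =
            segm n 1 i :&: segm n 1 (ihat n ns j i) by [].
  by apply/finset.setP => b; rewrite !inE; lia.
- by rewrite card_segm //; lia.
rewrite {}Nm; first last.
- move=> J JS cJ; apply: sign_skip => //; lia.
- move=> J; rewrite -finset.subsetI.
  suff -> : segm n 1 (minn i.+1 (ihat n ns j i)) :\: sing n i =
            skip i :&: segm n 1 (ihat n ns j i) by [].
  by apply/finset.setP => b; rewrite !inE; lia.
- by rewrite card_skip //; lia.
have c0 : (-1) ^+ (i * l + (l * l.-1)./2) * (lam j * mid_coef j i) != 0.
  apply: mulf_neq0; first by rewrite signr_eq0.
  by apply: mulf_neq0; [apply: lam_neq0 | apply: mid_coef_neq0 => //]; lia.
split; first by apply: mulf_neq0 => //; apply: h_minor; lia.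
by rewrite -mulf_div divff // mulr1.
Qed.

(** An index is either interior to a block or one of the boundaries [N j]; the bound [k] is there
    for the induction. *)
Lemma sum_blocks (f : nat -> F) (k : nat) : (k <= r)%N ->
  \sum_(1 <= i < N k.+1) f i =
  \sum_(1 <= i < N 1) f i + \sum_(1 <= j < k.+1) \sum_((N j).+1 <= i < N j.+1) f i
  + \sum_(1 <= j < k.+1) f (N j).
Proof.
elim: k => [|k IH] kr; first by rewrite ![\sum_(1 <= _ < 1) _]big_geq // !addr0.
have N1 : (1 <= N k.+1)%N by rewrite -[ltnLHS]/(N 0) (nn_ltn nsP) //; lia.
have N2 : (N k.+1 < N k.+2)%N by rewrite (nn_ltn nsP).
rewrite (big_cat_nat N1 (ltnW N2)) /= IH; last lia.
rewrite (big_ltn N2) [\sum_(1 <= j < k.+2) f (N j)]big_nat_recr //=.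
rewrite [\sum_(1 <= j < k.+2) \sum_(_ <= i < _) f i]big_nat_recr //=.
by ring.
Qed.

Lemma plucker_formula_hat (q : 'rV[F]_r) :
  denominators_neq0 ns g /\
  plucker_formula g q = \sum_(1 <= i < n) ratio i -
    \sum_(1 <= j < r.+1) ent q 1 j *
      (if insub (n - N j.+1)%N is Some c then (-1) ^+ N j * h (N j).-1 c else 0).
Proof.
have r1 : (0 < r)%N by case: nsP.
(* The column exists because [N j.+1] is positive, so the default branch of [insub] never occurs. *)
have cP j : (0 < j <= r)%N -> exists c : 'I_n,
    c = (n - N j.+1)%N :> nat /\ insub (n - N j.+1)%N = Some c.
  move=> jr; have cn : (n - N j.+1 < n)%N.
    have := @nn_ltn _ _ nsP 0 j.+1; rewrite -[N 0]/0%N.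
    by have := @nn_le_n _ _ nsP j.+1; lia.
  by exists (Ordinal cn); rewrite insubT.
split.
  split.
  - by move=> i /term_block0[].
  - by move=> j i jr ji; case: (term_mid jr ji).
  - by move=> i /term_blockr[].
  move=> j jr; have [c [cE _]] := cP j jr.
  by case: (term_boundary jr) => -> _; case: (term_q jr cE).
rewrite -[X in \sum_(1 <= i < X) ratio i](nnS_last n ns) sum_blocks //.
rewrite /plucker_formula.
rewrite [\sum_(1 <= j < r.+1) \sum_(_ <= i < _) _]big_nat_recr //= nnS_last addrA.
congr (_ + _ + _ + _ + _).
- rewrite big_nat [RHS]big_nat; apply: eq_bigr => i i1.
  by case: (term_block0 i1).
- rewrite big_nat [RHS]big_nat; apply: eq_bigr => j jr.
  rewrite big_nat [RHS]big_nat; apply: eq_bigr => i ji.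
  by case: (term_mid jr ji).
- rewrite big_nat [RHS]big_nat; apply: eq_bigr => i i1.
  by case: (term_blockr i1).
- rewrite big_nat [RHS]big_nat; apply: eq_bigr => j jr.
  by case: (term_boundary jr).
rewrite -sumrN big_nat [RHS]big_nat; apply: eq_bigr => j jr.
have [c [cE ->]] := cP j jr; case: (term_q jr cE) => _ ->.
by rewrite mulrN.
Qed.

End Evaluation.

(** * Inversions and dotted Weyl group elements *)

Section Inversions.
Variable n : nat.
Implicit Types (w : 'S_n) (a x y : 'I_n).

(** An inversion is counted at its later position because that row receives the sign in [dotw]. *)
Definition inv_at w a : nat := (\sum_(a' : 'I_n | (a' < a)%N) (w a < w a'))%N.
Definition inv_num w : nat := (\sum_a inv_at w a)%N.

(** Exchanging adjacent values alters only their mutual order. The new inversion has its later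
    position where [w] takes the value [y]. *)
Lemma inv_at_mul w x y a : y = x.+1 :> nat -> (w^-1 x < w^-1 y)%g%N ->
  inv_at (w * tperm x y)%g a = (inv_at w a + (w a == y))%N.
Proof.
move=> yx; set a0 := (w^-1 x)%g; set a1 := (w^-1 y)%g => lt01.
have w0 : w a0 = x by rewrite permKV.
have w1 : w a1 = y by rewrite permKV.
have wx b : (w b == x) = (b == a0) by rewrite -w0 (inj_eq perm_inj).
have wy b : (w b == y) = (b == a1) by rewrite -w1 (inj_eq perm_inj).
have xy : (x < y)%N by rewrite yx.
have tE b : b != a0 -> b != a1 -> (w * tperm x y)%g b = w b.
  by move=> b0 b1; rewrite permM tpermD // eq_sym ?wx ?wy.
have neq b : b != a0 -> b != a1 -> (w b != x :> nat) /\ (w b != y :> nat).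
  by rewrite -wx -wy.
have e0 : (w * tperm x y)%g a0 = y by rewrite permM w0 tpermL.
have e1 : (w * tperm x y)%g a1 = x by rewrite permM w1 tpermR.
have ord_cmp c d : (c != x :> nat) -> (c != y :> nat) ->
    (c < (w * tperm x y)%g d)%N = (c < w d)%N.
  move=> cx cy; have [->|d0] := eqVneq d a0; first by rewrite e0 w0; lia.
  by have [->|d1] := eqVneq d a1; [rewrite e1 w1; lia | rewrite tE].
rewrite /inv_at wy; have [->|n1] := eqVneq a a1.
  rewrite e1 w1 (bigD1 a0) //= [in RHS](bigD1 a0) //= e0 w0 xy.
  rewrite [(y < x)%N]ltnNge ltnW //= add0n addnC; congr (_ + _)%N.
  apply: eq_bigr => b /andP[ba b0].
  have b1 : b != a1 by apply: contraTneq ba => ->; rewrite ltnn.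
  by rewrite tE //; have [] := neq b b0 b1; lia.
rewrite addn0; have [->|n0] := eqVneq a a0.
  rewrite e0 w0; apply: eq_bigr => b ba.
  have b0 : b != a0 by apply: contraTneq ba => ->; rewrite ltnn.
  have b1 : b != a1 by apply: contraTneq ba => ->; rewrite -leqNgt ltnW.
  by rewrite tE //; have [] := neq b b0 b1; lia.
rewrite tE //; have [nx ny] := neq a n0 n1.
by apply: eq_bigr => b _; rewrite ord_cmp.
Qed.

Lemma inv_num_asc w x y : y = x.+1 :> nat -> (w^-1 x < w^-1 y)%g%N ->
  inv_num (w * tperm x y)%g = (inv_num w).+1.
Proof.
move=> yx lt; rewrite /inv_num; under eq_bigr do rewrite inv_at_mul //.
rewrite big_split /= -[in RHS]addn1; congr (_ + _)%N.
rewrite (bigD1 (w^-1 y)%g) //= permKV eqxx big1 // => b /negPf.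
by rewrite -(inj_eq (@perm_inj _ w)) permKV => ->.
Qed.

Lemma inv_num_desc w x y : y = x.+1 :> nat -> (w^-1 y < w^-1 x)%g%N ->
  inv_num w = (inv_num (w * tperm x y)%g).+1.
Proof.
move=> yx lt; rewrite -[in LHS](mulgK (tperm x y) w) tpermV; apply: inv_num_asc => //.
by rewrite invMg tpermV !permM tpermL tpermR.
Qed.

Lemma sreflE i : (0 < i < n)%N ->
  exists x y, [/\ x = i.-1 :> nat, y = i :> nat & srefl n i = tperm x y].
Proof.
move=> /andP[i0 i_n]; have i1 : (i.-1 < n)%N by lia.
by exists (Ordinal i1), (Ordinal i_n); rewrite /srefl !insubT.
Qed.

Lemma inv_neq w x y : y = x.+1 :> nat -> (w^-1 x != w^-1 y)%g.
Proof. by move=> yx; rewrite (inj_eq perm_inj) -val_eqE /= yx; lia. Qed.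

Lemma inv_num_srefl w i : (0 < i < n)%N ->
  (inv_num (w * srefl n i)%g <= (inv_num w).+1)%N.
Proof.
move=> i_n; have [x [y [xi yi ->]]] := sreflE i_n; have yx : y = x.+1 :> nat by lia.
case: (ltngtP (w^-1 x) (w^-1 y))%g => lt.
- by rewrite inv_num_asc.
- by rewrite [in leqRHS](inv_num_desc yx lt) ltnW.
by have := inv_neq w yx; rewrite -val_eqE /= lt eqxx.
Qed.

Lemma word_perm_rcons e i :
  word_perm n (rcons e i) = (word_perm n e * srefl n i)%g.
Proof. by rewrite /word_perm -cats1 big_cat big_seq1. Qed.

Lemma is_word_rcons e i : is_word n (rcons e i) = is_word n e && (0 < i < n)%N.
Proof. by rewrite /is_word all_rcons andbC. Qed.

Lemma inv_num_word e : is_word n e -> (inv_num (word_perm n e) <= size e)%N.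
Proof.
elim/last_ind: e => [_|e i IH].
  rewrite /word_perm big_nil leqn0 sum_nat_eq0; apply/forallP => a /=.
  rewrite sum_nat_eq0; apply/forallP => b; rewrite !perm1; apply/implyP.
  by rewrite ltnNge => /negPf; rewrite leq_eqVlt => /norP[_ /negPf->] || lia.
rewrite is_word_rcons => /andP[we i_n]; rewrite word_perm_rcons size_rcons.
by apply: leq_trans (inv_num_srefl _ i_n) _; rewrite ltnS IH.
Qed.

(** Strict growth forces [f i] to be at least [i] when counting up from [lo] and at most [i] when
    counting down from [hi]. *)
Lemma increasing_id (f : nat -> nat) (lo hi : nat) :
  (forall i, (lo <= i < hi)%N -> (lo <= f i < hi)%N) ->
  (forall i, (lo <= i)%N -> (i.+1 < hi)%N -> (f i < f i.+1)%N) ->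
  forall i, (lo <= i < hi)%N -> f i = i.
Proof.
move=> fb fi.
have ge k : (lo + k < hi)%N -> (lo + k <= f (lo + k))%N.
  elim: k => [|k IH] kh; first by rewrite !addn0; have := fb lo; lia.
  by have := fi (lo + k)%N; rewrite -!addnS; have := IH; lia.
have le k : (lo + k < hi)%N -> (f (hi - k.+1) <= hi - k.+1)%N.
  elim: k => [|k IH] kh; first by have := fb (hi - 1)%N; lia.
  have := fi (hi - k.+2)%N; rewrite -subSn ?subSS; last lia.
  by have := IH; lia.
move=> i ib; have := ge (i - lo)%N; have := le (hi - i.+1)%N.
have -> : (hi - (hi - i.+1).+1 = i)%N by lia.
have -> : (lo + (i - lo) = i)%N by lia.
lia.
Qed.

Lemma no_descent w : (forall x y, y = x.+1 :> nat -> (w^-1 x < w^-1 y)%g%N) -> w = 1%g.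
Proof.
move=> asc; apply: invg_inj; rewrite invg1; apply/permP => x; rewrite perm1.
pose f i := if insub i is Some z then nat_of_ord (w^-1 z)%g else i.
have fE (z : 'I_n) : f z = (w^-1 z)%g by rewrite /f valK.
apply: ord_inj; rewrite -fE; apply: (@increasing_id f 0 n) => [i|i _ i_n|].
- by move=> /= i_n; rewrite (fE (Ordinal i_n)) /=.
- by have := asc (Ordinal (ltnW i_n)) (Ordinal i_n) erefl; rewrite -!fE.
exact: ltn_ord.
Qed.

Lemma word_exists w :
  exists e, [/\ is_word n e, word_perm n e = w & size e = inv_num w].
Proof.
have [m] := ubnP (inv_num w); elim: m w => // m IH w wm.
have [[x [y [yx lt]]]|asc] :=
  pselect (exists x y, y = x.+1 :> nat /\ (w^-1 y < w^-1 x)%g%N).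
  have Ew := inv_num_desc yx lt.
  have [e [we pe se]] := IH (w * tperm x y)%g ltac:(lia).
  have yn : (0 < y < n)%N by rewrite ltn_ord yx.
  exists (rcons e y); rewrite is_word_rcons we word_perm_rcons pe size_rcons se -Ew yn.
  split=> //; have [x' [y' [ex ey ->]]] := sreflE yn.
  have -> : x' = x by apply: val_inj => /=; rewrite ex yx.
  have -> : y' = y by apply: val_inj.
  by rewrite -{2}[tperm x y]tpermV mulgK.
have w1 : w = 1%g.
  apply: no_descent => x y yx; case: ltngtP => // lt.
    by case: asc; exists x, y.
  by have := inv_neq w yx; rewrite -val_eqE /= lt eqxx.
exists [::]; rewrite w1 /word_perm big_nil; split => //.
by apply/esym/eqP; rewrite -leqn0; have := @inv_num_word [::] isT;
  rewrite /word_perm big_nil.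
Qed.

(** Sorting by descents gives a word of length [inv_num w], and no word is shorter since a letter
    raises the inversion number by at most one. Hence the word chosen by [redexp] has exactly this
    length. *)
Lemma redexpP w : [/\ is_word n (redexp w), word_perm n (redexp w) = w
  & size (redexp w) = inv_num w].
Proof.
have [e [we pe se]] := word_exists w.
have [w1 w2 w3] : reduced_expression w (redexp w).
  apply: (@xgetPex _ [::] [set e | reduced_expression w e]%classic).
  exists e; split => // e' we' pe'; rewrite se -pe'; exact: inv_num_word.
split=> //; apply/eqP; rewrite eqn_leq; apply/andP; split.
  by rewrite -se; apply: w3.
by have := inv_num_word w1; rewrite w2.
Qed.

Lemma len_inv w : len w = inv_num w.
Proof. by rewrite /len; case: (redexpP w). Qed.

(** At an ascent, multiplication by the transposition would stay in [W] and increase the length. The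
    inverse appears because right multiplication acts on values. *)
Lemma longest_desc (W : {set 'S_n}) x y : (1%g \in W) -> y = x.+1 :> nat ->
  (forall w, w \in W -> (w * tperm x y)%g \in W) ->
  longest W \in W /\ ((longest W)^-1 y < (longest W)^-1 x)%g%N.
Proof.
move=> W1 yx Ws; rewrite /longest.
case: arg_maxnP => // w wW wmax; split => //.
case: ltngtP => // lt.
  have /= := wmax _ (Ws w wW).
  by rewrite /geq /= !len_inv (inv_num_asc yx) // ltnn.
by have := inv_neq w yx; rewrite -val_eqE /= lt eqxx.
Qed.

End Inversions.

(** * Matrices of dotted Weyl group elements *)

Section Dots.
Variables (F : fieldType) (n : nat).

Lemma expN_square0 (M : 'M[F]_n) : (1 < n)%N -> M *m M = 0 -> expN M = 1%:M + M.
Proof.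
move=> n1 M2; rewrite /expN -(big_mkord xpredT (fun k => (k`!%:R)^-1 *: M ^+ k)).
rewrite big_ltn; last lia.
rewrite big_ltn // expr0 expr1 fact0 invr1 !scale1r big_nat big1 ?addr0 // => k.
case: k => [|[|k]] // _; rewrite !exprS mulrA -[M * M]/(M *m M) M2.
by rewrite mul0r scaler0.
Qed.

Lemma Eunit_delta i j (x y : 'I_n) : i = x.+1 -> j = y.+1 ->
  Eunit F n i j = delta_mx x y.
Proof. by move=> -> ->; apply/matrixP => a b; rewrite !mxE !eqSS. Qed.

Lemma sdotE i (x y : 'I_n) : x = i.-1 :> nat -> y = i :> nat -> (0 < i)%N ->
  sdot F n i = \matrix_(c, b) ((-1) ^+ (c == y) *+ (b == tperm x y c)).
Proof.
move=> xi yi i0; have xy : (x == y) = false by rewrite -val_eqE /= xi yi; lia.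
have n1 : (1 < n)%N by have := ltn_ord y; lia.
have yx : (y == x) = false by rewrite eq_sym.
rewrite /sdot (@Eunit_delta i i.+1 x y) ?(@Eunit_delta i.+1 i y x) ?xi ?yi ?prednK //.
rewrite !expN_square0 ?mulmxN ?mulNmx ?mul_delta_mx_0 ?oppr0 ?xy ?yx //.
rewrite mulmxDl mul1mx [delta_mx x y *m _]mulmxDr mulmx1 mulmxN mul_delta_mx.
rewrite !mulmxDl !mul1mx !mulmxDr !mulmx1 !mulNmx !mul_delta_mx mul_delta_mx_0 ?yx
  ?addr0 //.
apply/matrixP => c b; rewrite !mxE.
case: tpermP => [->|->|/eqP/negPf cx /eqP/negPf cy].
- rewrite !eqxx xy eq_sym; case: (b =P x) => [->|_]; rewrite ?xy ?eqxx /=; [ring|].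
  by case: (b =P y) => _ /=; ring.
- rewrite !eqxx yx eq_sym; case: (b =P x) => [->|_]; rewrite ?xy ?eqxx /=; [ring|].
  by case: (b =P y) => _ /=; ring.
by rewrite cx cy /= eq_sym; ring.
Qed.

(** A letter puts its sign into the row whose current value is the larger of the two exchanged. In a
    reduced word this is the row where [inv_at_mul] records the new inversion. *)
Lemma dotwE (w : 'S_n) :
  dotw F w = \matrix_(a, b) ((-1) ^+ inv_at w a *+ (b == w a)).
Proof.
have [we pe se] := redexpP w; rewrite /dotw -[w in RHS]pe.
move: se; rewrite -{2}pe; move: we; elim/last_ind: (redexp w) => [_ _|e i IH].
  rewrite big_nil /word_perm big_nil; apply/matrixP => a b; rewrite !mxE perm1 eq_sym.
  rewrite /inv_at big1 ?expr0 // => c ca; rewrite !perm1.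
  by rewrite ltnNge ltnW.
rewrite is_word_rcons => /andP[we i_n]; rewrite size_rcons word_perm_rcons.
have [x [y [xi yi sE]]] := sreflE i_n; rewrite sE => se.
have yx : y = x.+1 :> nat by lia.
set w' := word_perm n e in se *.
have le := inv_num_word we; rewrite -/w' in le.
(* A descent would give the prefix more inversions than it has letters. *)
have lt : (w'^-1 x < w'^-1 y)%g%N.
  case: (ltngtP (w'^-1 x) (w'^-1 y))%g => // lt.
    by have := inv_num_desc yx lt; lia.
  by have := inv_neq w' yx; rewrite -val_eqE /= lt eqxx.
have Ew := inv_num_asc yx lt.
rewrite -cats1 big_cat big_seq1 /= IH //; last by rewrite -/w'; lia.
rewrite (sdotE xi yi); last lia.
apply/matrixP => a b; rewrite !mxE (bigD1 (w' a)) //= big1 ?addr0; last first.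
  by move=> c ca; rewrite !mxE (negPf ca) mul0r.
rewrite !mxE eqxx mulr1n inv_at_mul // exprD permM mulrnAr.
by case: (w' a == y).
Qed.

End Dots.

Section SignedPerm.
Variables (F : fieldType) (n : nat).

Definition signed_perm (s : 'I_n -> nat) (w : 'S_n) : 'M[F]_n :=
  \matrix_(a, b) ((-1) ^+ s a *+ (b == w a)).

Lemma signed_perm_mulE s w m (A : 'M[F]_(n, m)) a b :
  (signed_perm s w *m A) a b = (-1) ^+ s a * A (w a) b.
Proof.
rewrite mxE (bigD1 (w a)) //= big1 ?addr0 => [|c ca]; first by rewrite mxE eqxx.
by rewrite mxE (negPf ca) mul0r.
Qed.

Lemma mul_signed_permE s w m (A : 'M[F]_(m, n)) a b :
  (A *m signed_perm s w) a (w b) = A a b * (-1) ^+ s b.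
Proof.
rewrite mxE (bigD1 b) //= big1 ?addr0 => [|c cb]; first by rewrite mxE eqxx.
by rewrite mxE (inj_eq perm_inj) eq_sym (negPf cb) mulr0.
Qed.

Lemma signed_perm_mulT s w : signed_perm s w *m (signed_perm s w)^T = 1%:M.
Proof.
apply/matrixP => a b; rewrite signed_perm_mulE !mxE (inj_eq perm_inj).
by case: (a =P b) => [->|_]; rewrite ?mulr0 // -expr2 sqrr_sign.
Qed.

Lemma signed_perm_unit s w : signed_perm s w \in unitmx.
Proof. by case/mulmx1_unit: (signed_perm_mulT s w). Qed.

Lemma invmx_signed_perm s w : invmx (signed_perm s w) = (signed_perm s w)^T.
Proof.
by rewrite -[RHS](mulKmx (signed_perm_unit s w)) signed_perm_mulT mulmx1.
Qed.

End SignedPerm.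

(** * The longest elements and the signed permutation [wPw0] *)

Section LongestElements.
Variables (n : nat) (ns : seq nat).
Hypothesis nsP : is_IP n ns.
Notation N := (nn n ns).
Notation r := (size ns).
Notation blk := (block_of n ns).
Notation hat := (pivot_col n ns).

Lemma decreasing_rev (v : 'S_n) lo hi : (hi <= n)%N ->
    (forall x : 'I_n, (lo <= x < hi)%N -> (lo <= v x < hi)%N) ->
    (forall x y : 'I_n, y = x.+1 :> nat -> (lo <= x)%N -> (y < hi)%N ->
      (v y < v x)%N) ->
  forall x : 'I_n, (lo <= x < hi)%N -> v x = (lo + hi - x.+1)%N :> nat.
Proof.
move=> hin vb vd.
pose f i := if insub i is Some x then (lo + hi - (v x).+1)%N else i.
have fE (x : 'I_n) : f x = (lo + hi - (v x).+1)%N by rewrite /f valK.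
have f_id i : (lo <= i < hi)%N -> f i = i.
  apply: increasing_id => [k kb|k lk kh].
    have kn : (k < n)%N by lia.
    by rewrite (fE (Ordinal kn)); have := vb (Ordinal kn) kb; lia.
  have kn : (k.+1 < n)%N by lia.
  have := vd (Ordinal (ltnW kn)) (Ordinal kn) erefl lk kh.
  rewrite (fE (Ordinal kn)) (fE (Ordinal (ltnW kn))).
  have := vb (Ordinal kn); have := vb (Ordinal (ltnW kn)) => /=; lia.
move=> x xb; have := f_id _ xb; rewrite fE; have := vb x xb; lia.
Qed.

Lemma w0_inv (a : 'I_n) : ((w0 n)^-1 a)%g = (n - a.+1)%N :> nat.
Proof.
have -> : (n - a.+1 = 0 + n - a.+1)%N by [].
apply: (@decreasing_rev _ 0 n) => //= x y yx _ _.
have [] // := @longest_desc n [set: 'S_n] x y (finset.in_setT _) yx => w _.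
exact: finset.in_setT.
Qed.

Lemma w0E (a : 'I_n) : w0 n a = (n - a.+1)%N :> nat.
Proof. by have := w0_inv (w0 n a); rewrite permK; have := ltn_ord (w0 n a); lia. Qed.

Lemma w0V : ((w0 n)^-1 = w0 n)%g.
Proof. by apply/permP => a; apply: val_inj; rewrite /= w0_inv w0E. Qed.

Lemma blk_eqS a : (a.+1 < n)%N -> (blk a == blk a.+1) = (a.+1 \notin ns).
Proof.
move=> an; have [br /andP[b1 b2]] := blkP ns (ltnW an).
apply/eqP/idP => [e|nns].
  apply/negP => /(mem_nn n ns _)[j jr aj].
  have bj : blk a.+1 = j.
    by apply: (blk_unique nsP); rewrite ?aj ?leqnn ?(nn_ltn nsP) //; lia.
  by move: b1; rewrite e bj; lia.
apply/esym/(blk_unique nsP) => //; apply/andP; split; first lia.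
rewrite ltn_neqAle b2 andbT; apply: contra nns => /eqP aN.
have br' : (blk a < r)%N.
  rewrite ltn_neqAle br andbT; apply/eqP => e; move: aN; rewrite e nnS_last; lia.
by apply/(mem_nn n ns _); exists (blk a).+1; rewrite ?aN.
Qed.

Lemma mem_IsubP i : (i \in IsubP n ns) = (0 < i < n)%N && (i \notin ns).
Proof. by rewrite mem_filter mem_iota andbC; congr (_ && _); lia. Qed.

Lemma tperm_WP (x y : 'I_n) : y = x.+1 :> nat -> blk x = blk y -> tperm x y \in WP n ns.
Proof.
move=> yx bxy; have yn : (0 < y < n)%N by rewrite ltn_ord yx.
apply: mem_gen; rewrite inE; apply/mapP; exists (y : nat).
  by rewrite mem_IsubP yn yx -blk_eqS -?yx ?ltn_ord // bxy eqxx.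
have [x' [y' [ex ey ->]]] := sreflE yn.
by congr tperm; apply: val_inj; rewrite /= ?ex ?ey ?yx.
Qed.

Lemma blk_WP (w : 'S_n) (a : 'I_n) : w \in WP n ns -> blk (w a) = blk a.
Proof.
move=> /gen_prodgP[m [c cW ->]]; move: a.
apply: (@big_ind _ (fun w : 'S_n => forall a, blk (w a) = blk a)).
- by move=> a; rewrite perm1.
- by move=> u v bu bv a; rewrite permM bv bu.
move=> i _ a; have := cW i; rewrite inE => /mapP[k];
  rewrite mem_IsubP => /andP[kn kns] ->.
have [x [y [ex ey ->]]] := sreflE kn.
have bxy : blk x = blk y.
  have yx : y = x.+1 :> nat by lia.
  by apply/eqP; rewrite yx blk_eqS -?yx ?ltn_ord // ey.
by case: tpermP => // ->.
Qed.

Lemma wP_in : wP n ns \in WP n ns.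
Proof. by rewrite /wP /longest; case: arg_maxnP => //; apply: group1. Qed.

Lemma wP_inv (a : 'I_n) :
  ((wP n ns)^-1 a)%g = (N (blk a) + N (blk a).+1 - a.+1)%N :> nat.
Proof.
have [ba pa] := blkP ns (ltn_ord a).
apply: decreasing_rev (pa); first exact: nn_le_n.
  move=> x xb; have bx := blk_unique nsP ba xb.
  have <- : blk ((wP n ns)^-1 x)%g = blk a by rewrite blk_WP ?groupV ?wP_in.
  by case: (blkP ns (ltn_ord ((wP n ns)^-1 x)%g)).
move=> x y yx lx hy.
have bxy : blk x = blk y by rewrite !(blk_unique nsP ba) //; lia.
have [] // := @longest_desc n (WP n ns) x y (group1 _) yx => w wW.
by rewrite groupM // tperm_WP.
Qed.

Lemma wPE (a : 'I_n) : wP n ns a = (N (blk a) + N (blk a).+1 - a.+1)%N :> nat.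
Proof.
have := wP_inv (wP n ns a); rewrite permK blk_WP ?wP_in //.
have [_ ] := blkP ns (ltn_ord a); have [_] := blkP ns (ltn_ord (wP n ns a)).
by rewrite blk_WP ?wP_in //; lia.
Qed.

Lemma inv_at_w0 a : inv_at (w0 n) a = a.
Proof.
rewrite /inv_at (eq_bigr (fun=> 1%N)); last first.
  by move=> b ba; rewrite !w0E; have := ltn_ord a; lia.
rewrite sum1_card; transitivity #|segm n 1 a|; last by rewrite card_segm ?subn1 // ltnW.
by apply: eq_card => b; rewrite !inE.
Qed.

Lemma inv_at_wP a : inv_at (wP n ns) a = (a - N (blk a))%N.
Proof.
have [ba pa] := blkP ns (ltn_ord a).
transitivity #|segm n (N (blk a)).+1 a|; last by rewrite card_segm // ltnW.
rewrite -sum1_card /inv_at big_mkcond [RHS]big_mkcond /=; apply: eq_bigr => b _.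
rewrite inE ltnS andbC; case: ltnP => // lt_ba /=.
have [bb pb] := blkP ns (ltn_ord b).
have le := blk_leq nsP (ltn_ord a) (ltnW lt_ba).
have [lo|lo] := leqP (N (blk a)) b.
  have e : blk b = blk a by apply: (blk_unique nsP) => //; lia.
  by rewrite !wPE e; lia.
have ne : (blk b < blk a)%N.
  by rewrite ltn_neqAle le andbT; apply: contraTneq lo => <-; lia.
rewrite !wPE; have := @nn_leq _ _ nsP (blk b).+1 (blk a) (leqW ba) ne; lia.
Qed.

Definition pivot_perm : 'S_n := ((wP n ns)^-1 * w0 n)%g.

Lemma sigmaE (a : 'I_n) : pivot_perm a = hat a :> nat.
Proof.
rewrite permM w0E wP_inv /pivot_col; have [ba pa] := blkP ns (ltn_ord a).
by have := @nn_le_n _ _ nsP (blk a).+1 ba; lia.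
Qed.

Variable F : fieldType.

(** With [c] the mirror image of [a] in its block, [wP] contributes [c - N (blk a)] signs and [w0]
    contributes [c]; modulo 2 only [N (blk a)] is left. *)
Lemma wPw0E : wPw0 F n ns = signed_perm F (fun a => N (blk a)) pivot_perm.
Proof.
rewrite /wPw0 !dotwE -!/(signed_perm _ _ _) invmx_signed_perm.
apply/matrixP => a b; rewrite mxE (bigD1 ((wP n ns)^-1 a)%g) //= big1 ?addr0;
  last first.
  move=> c; rewrite -(inj_eq (@perm_inj _ (wP n ns))) permKV => /negPf ca.
  by rewrite !mxE eq_sym ca mul0r.
rewrite !mxE permKV eqxx mulr1n -permM -/pivot_perm mulrnAr -exprD; congr (_ *+ _).
rewrite inv_at_w0 inv_at_wP blk_WP ?groupV ?wP_in // wP_inv.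
have [ba pa] := blkP ns (ltn_ord a).
set u := N _ in pa *; set v := N _ in pa *; set c := (_ + _)%N.
have -> : c = (u + (v - a.+1) * 2)%N by rewrite /c; lia.
by rewrite exprD exprM sqrr_sign mulr1.
Qed.

Lemma dotw_RichardsonE :
  dotw F (w0 n * wP n ns)^-1%g = signed_perm F (inv_at pivot_perm) pivot_perm.
Proof. by rewrite invMg w0V -/pivot_perm dotwE. Qed.

End LongestElements.

(** * The torus fixed by W_P and its coordinates *)

Section Torus.
Variables (F : fieldType) (n : nat) (ns : seq nat).
Hypothesis nsP : is_IP n ns.
Notation N := (nn n ns).
Notation r := (size ns).
Notation blk := (block_of n ns).

Lemma ent_eq m p (A : 'M[F]_(m, p)) (a : 'I_m) (b : 'I_p) i j :
  i = a.+1 -> j = b.+1 -> ent A i j = A a b.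
Proof. by move=> -> ->; apply: entE. Qed.

Lemma dotw_signed (w : 'S_n) : dotw F w = signed_perm F (inv_at w) w.
Proof. exact: dotwE. Qed.

Lemma torusWP_blk (t : 'M[F]_n) (x y : 'I_n) : torusWP ns t ->
  y = x.+1 :> nat -> blk x = blk y -> t x x = t y y.
Proof.
move=> [[_ /is_diag_mxP td] _ tW] yx bxy.
have := tW _ (tperm_WP nsP yx bxy); rewrite dotw_signed.
set M := signed_perm _ _ _ => H.
have {}H : M *m t = t *m M.
  by rewrite -[in RHS]H mulmxKV // signed_perm_unit.
have := congr1 (fun A : 'M[F]_n => A x (tperm x y x)) H.
rewrite signed_perm_mulE mul_signed_permE tpermL [RHS]mulrC.
by move/(mulfI _)->; rewrite // signr_eq0.
Qed.

Lemma torusWP_intro (d : 'I_n -> F) :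
  (forall a, d a != 0) -> (forall a : 'I_n, a.+1 = n -> d a = 1) ->
  (forall a b : 'I_n, blk a = blk b -> d a = d b) ->
  torusWP ns (\matrix_(a, b) (d a *+ (a == b))).
Proof.
move=> d0 dn db; set t := \matrix_(a, b) _.
have tE : t = diag_mx (\row_a d a) by apply/matrixP => a b; rewrite !mxE.
split.
- split; last by rewrite tE diag_mx_is_diag.
  rewrite /GL /= tE unitmxE det_diag unitfE; apply/prodf_neq0 => a _.
  by rewrite mxE.
- have n0 : (0 < n)%N by have := @nn_lt_n _ _ nsP 0 (leq0n _); lia.
  have n1 : (n.-1 < n)%N by lia.
  rewrite (@ent_eq _ _ t (Ordinal n1) (Ordinal n1)) /= ?prednK // mxE eqxx.
  by rewrite dn //= prednK.
move=> w wW; rewrite dotw_signed; set M := signed_perm _ _ _.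
suff -> : M *m t = t *m M by rewrite mulmxK // signed_perm_unit.
apply/matrixP => a b; rewrite -[b](permKV w) mul_signed_permE signed_perm_mulE !mxE.
rewrite (inj_eq perm_inj) mulrnAl mulrnAr mulrC.
case: (a =P _) => // <-; rewrite (db (w a) a) //; exact: (blk_WP nsP).
Qed.

Lemma torusWP_exists (q : 'rV[F]_r) : (forall j, q 0 j != 0) ->
  exists t : 'M[F]_n, torusWP ns t /\ qcoord ns t = q.
Proof.
(* Solves [t_(n_j) / t_(n_j + 1) = q_(n_j)] with last entry [1]: passing the boundary [n_j] drops
   exactly the factor [q_(n_j)]. *)
move=> q0; pose d (a : nat) : F := \prod_(j < r | (a < N j.+1)%N) q 0 j.
exists (\matrix_(a, b) (d a *+ (a == b))); split.
  apply: torusWP_intro => [a|a an|a b bab].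
  - by apply/prodf_neq0.
  - rewrite /d big1 // => j aj; have := @nn_lt_n _ _ nsP j.+1 (ltn_ord j); lia.
  apply: eq_bigl => j.
  suff H (c : 'I_n) : (c < N j.+1)%N = (blk c < j.+1)%N by rewrite !H bab.
  have [bc pc] := blkP ns (ltn_ord c).
  apply/idP/idP => [cj|cj].
    rewrite ltnNge; apply/negP => le.
    by have := @nn_leq _ _ nsP j.+1 (blk c) (leqW bc) le; lia.
  by have := @nn_leq _ _ nsP (blk c).+1 j.+1 (leqW (ltn_ord j)) cj; lia.
apply/rowP => j; rewrite mxE /=.
have jn := @nn_lt_n _ _ nsP j.+1 (ltn_ord j).
have j0 : (0 < N j.+1)%N by have := @nn_ltn _ _ nsP 0 j.+1 (leqW (ltn_ord j)); lia.
have jn' : ((N j.+1).-1 < n)%N by lia.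
have e' : N j.+1 = (Ordinal jn').+1 by rewrite /= prednK.
rewrite (ent_eq _ e' e') (@ent_eq _ _ _ (Ordinal jn) (Ordinal jn)) // !mxE !eqxx
  !mulr1n /d /=.
rewrite (bigD1 j) /=; last by rewrite prednK.
rewrite [X in _ * X / _](_ : _ = \prod_(i < r | (N j.+1 < N i.+1)%N) q 0 i).
  by rewrite mulfK //; apply/prodf_neq0.
apply: eq_bigl => i; have [ij|ij|ij] := ltngtP i j.
- have := @nn_ltn _ _ nsP i.+1 j.+1 (leqW (ltn_ord j)); rewrite -val_eqE /=; lia.
- have := @nn_ltn _ _ nsP j.+1 i.+1 (leqW (ltn_ord i)); rewrite -val_eqE /=; lia.
by rewrite ij ltnn -val_eqE /= ij eqxx andbF.
Qed.

Lemma qcoordE (t : 'M[F]_n) j (x y : 'I_n) : (0 < j <= r)%N ->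
  x = (N j).-1 :> nat -> y = N j :> nat -> ent (qcoord ns t) 1 j = t x x / t y y.
Proof.
move=> jr xj yj; have jr' : (j.-1 < r)%N by lia.
have j0 : (0 < N j)%N by have := @nn_ltn _ _ nsP 0 j; lia.
have ej : j = (Ordinal jr').+1 by rewrite /=; lia.
have ex : N j = x.+1 by lia.
have ey : (N j).+1 = y.+1 by lia.
rewrite (@ent_eq _ _ _ 0 _ _ _ (erefl _) ej) mxE /=.
by rewrite prednK ?(ent_eq _ ex ex) ?(ent_eq _ ey ey) //; lia.
Qed.

End Torus.

(** * Triangular matrices *)

Section Triangular.
Variable F : fieldType.

Definition block_lower n m (A : 'M[F]_n) :=
  forall a b : 'I_n, (a < m)%N -> (m <= b)%N -> A a b = 0.

(** The upper right block of [invmx A *m A = 1] says that the upper right block of the inverse times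
    the lower right block of [A] is zero, and the latter is invertible because the determinant
    factors. *)
Lemma block_lower_inv n m (A : 'M[F]_n) :
  A \in unitmx -> block_lower m A -> block_lower m (invmx A).
Proof.
have [mn|nm] := leqP m n; last first.
  by move=> _ _ a b _ mb; have := ltn_ord b; lia.
move: A; rewrite -(subnKC mn); set k := (n - m)%N => A Au A0.
have ur0 : ursubmx A = 0.
  by apply/matrixP => a b; rewrite !mxE A0 //= leq_addr.
have dru : drsubmx A \in unitmx.
  move: Au; rewrite !unitmxE -[in \det A](submxK A) ur0 det_lblock unitrM.
  by case/andP.
have : ursubmx (invmx A *m A) = 0.
  by rewrite mulVmx //; apply/matrixP => a b;
    rewrite !mxE -val_eqE /= ltn_eqF // ltn_addr.
rewrite -[in invmx A *m A](submxK (invmx A)) -[X in _ *m X](submxK A) ur0.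
rewrite mulmx_block block_mxKur mulmx0 add0r => e0.
have {}e0 : ursubmx (invmx A) = 0 by rewrite -(mulmxK dru (ursubmx _)) e0 mul0mx.
move=> a b am mb; have bk : (b - m < k)%N by have := ltn_ord b; lia.
have := congr1 (fun B : 'M_(m, k) => B (Ordinal am) (Ordinal bk)) e0.
rewrite !mxE => <-; congr (invmx A _ _); apply: val_inj => //=.
by rewrite subnKC.
Qed.

Variable n : nat.
Implicit Types A B : 'M[F]_n.

(** Reduces inversion of triangular matrices to inversion of block triangular ones, one cut at a
    time. *)
Lemma trig_blockP A : is_trig_mx A <-> forall m, block_lower m A.
Proof.
split=> [/is_trig_mxP A0 m a b am mb|A0]; first by apply: A0; apply: leq_trans mb.
by apply/is_trig_mxP => a b ab; apply: (A0 b).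
Qed.

Lemma trig_mul A B : is_trig_mx A -> is_trig_mx B -> is_trig_mx (A *m B).
Proof.
move=> /is_trig_mxP A0 /is_trig_mxP B0; apply/is_trig_mxP => a b ab.
rewrite mxE big1 // => c _; have [ca|ac] := leqP c a.
  by rewrite B0 ?mulr0 // (leq_ltn_trans ca).
by rewrite A0 ?mul0r.
Qed.

Lemma trig_mul_diag A B a : is_trig_mx A -> is_trig_mx B ->
  (A *m B) a a = A a a * B a a.
Proof.
move=> /is_trig_mxP A0 /is_trig_mxP B0.
rewrite mxE (bigD1 a) //= big1 ?addr0 // => c ca.
case: (ltngtP c a) => lt; first by rewrite B0 ?mulr0.
  by rewrite A0 ?mul0r.
by rewrite (val_inj lt) eqxx in ca.
Qed.

Lemma trig_inv A : A \in unitmx -> is_trig_mx A -> is_trig_mx (invmx A).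
Proof. by move=> Au /trig_blockP A0; apply/trig_blockP => m;
  apply: block_lower_inv. Qed.

Lemma trig_unit A : is_trig_mx A -> (A \in unitmx) = [forall a, A a a != 0].
Proof.
move=> At; rewrite unitmxE det_trig // unitfE.
apply/prodf_neq0/forallP => H a; [exact: H | by move=> _; apply: H].
Qed.

Lemma Bminus_mul A B : Bminus F n A -> Bminus F n B -> Bminus F n (A *m B).
Proof.
move=> [Au At] [Bu Bt]; split; last exact: trig_mul.
by rewrite /GL /= unitmx_mul; apply/andP.
Qed.

Lemma Bminus_inv A : Bminus F n A -> Bminus F n (invmx A).
Proof.
by move=> [Au At]; split; [rewrite /GL /= unitmx_inv | apply: trig_inv].
Qed.

Lemma Bplus_tr A : Bplus F n A <-> Bminus F n A^T.
Proof. by rewrite /Bplus /Bminus /GL /= unitmx_tr. Qed.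

Lemma Bplus_mul A B : Bplus F n A -> Bplus F n B -> Bplus F n (A *m B).
Proof. by rewrite !Bplus_tr trmx_mul => ? ?; apply: Bminus_mul. Qed.

Lemma Bplus_inv A : Bplus F n A -> Bplus F n (invmx A).
Proof. by rewrite !Bplus_tr trmx_inv; apply: Bminus_inv. Qed.

Lemma Bminus_diag A a : Bminus F n A -> A a a != 0.
Proof. by case=> Au At; move: Au; rewrite /GL /= trig_unit // => /forallP. Qed.

Lemma Bplus_diag A a : Bplus F n A -> A a a != 0.
Proof. by move=> /Bplus_tr/(Bminus_diag a); rewrite mxE. Qed.

Lemma Bplus_mul_diag A B a : Bplus F n A -> Bplus F n B ->
  (A *m B) a a = A a a * B a a.
Proof.
move=> [_ At] [_ Bt].
by rewrite -[A *m B]trmxK trmx_mul mxE trig_mul_diag // !mxE mulrC.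
Qed.

Lemma Bplus0 A (a b : 'I_n) : Bplus F n A -> (b < a)%N -> A a b = 0.
Proof. by move=> [_ /is_trig_mxP At] ba; rewrite -[A]trmxK mxE At. Qed.

Lemma Bminus0 A (a b : 'I_n) : Bminus F n A -> (a < b)%N -> A a b = 0.
Proof. by move=> [_ /is_trig_mxP At] ab; apply: At. Qed.

Lemma Bminus_intro A : (forall a b : 'I_n, (a < b)%N -> A a b = 0) ->
  (forall a, A a a != 0) -> Bminus F n A.
Proof.
move=> A0 Ad; have At : is_trig_mx A by apply/is_trig_mxP.
by split=> //; rewrite /GL /= trig_unit //; apply/forallP.
Qed.

Lemma Bplus_intro A : (forall a b : 'I_n, (b < a)%N -> A a b = 0) ->
  (forall a, A a a != 0) -> Bplus F n A.
Proof.
move=> A0 Ad; apply/Bplus_tr; apply: Bminus_intro => a; last by rewrite mxE.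
by move=> b ab; rewrite mxE A0.
Qed.

Lemma Uplus_mul A B : Uplus F n A -> Uplus F n B -> Uplus F n (A *m B).
Proof.
move=> [Au A1] [Bu B1]; split; first exact: Bplus_mul.
by move=> a; rewrite Bplus_mul_diag // A1 B1 mulr1.
Qed.

Lemma Uplus_inv A : Uplus F n A -> Uplus F n (invmx A).
Proof.
move=> [Au A1]; have iAu := Bplus_inv Au; split => // a.
have := Bplus_mul_diag a Au iAu; rewrite mulmxV ?A1 ?mul1r; last by case: Au.
by rewrite mxE eqxx.
Qed.

Lemma Bminus1 : Bminus F n 1%:M.
Proof.
by apply: Bminus_intro => a; [move=> b ab|];
  rewrite mxE ?eqxx ?oner_eq0 // -val_eqE ltn_eqF.
Qed.

Lemma diag_matrix_mul (d : 'I_n -> F) A a b :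
  ((\matrix_(x, y) (d x *+ (x == y))) *m A) a b = d a * A a b.
Proof.
rewrite mxE (bigD1 a) //= big1 ?addr0 => [|c ca]; first by rewrite mxE eqxx.
by rewrite mxE eq_sym (negPf ca) mul0r.
Qed.

Lemma mul_diag_matrix (d : 'I_n -> F) A a b :
  (A *m (\matrix_(x, y) (d x *+ (x == y)))) a b = A a b * d b.
Proof.
rewrite mxE (bigD1 b) //= big1 ?addr0 => [|c cb]; first by rewrite mxE eqxx.
by rewrite mxE (negPf cb) mulr0.
Qed.

End Triangular.

(* LU decomposition by pivoting on the diagonal; the Schur complement of a
   matrix supported on the partial order [sigma] is again supported on it. *)
Lemma ordered_LU (F : fieldType) n (sigma : 'I_n -> nat) (M : 'M[F]_n) :
    (forall i, M i i != 0) ->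
    (forall i j, i != j -> ~~ (sigma j < sigma i)%N -> M i j = 0) ->
  exists L U : 'M[F]_n,
    [/\ M = L *m U, is_trig_mx L, is_trig_mx U^T &
     [/\ forall i, L i i = M i i, forall i, U i i = 1 &
      forall i j, i != j -> ~~ (sigma j < sigma i)%N -> L i j = 0 /\ U i j = 0]].
Proof.
elim: n sigma M => [|n IH] sigma M Md Ms.
  exists 1%:M, 1%:M; split; rewrite ?mulmx1 ?trmx1 ?scalar_mx_is_trig //.
    by apply/matrixP => -[].
  by split=> -[].
pose l (i : 'I_n) : 'I_n.+1 := lift ord0 i.
pose a := M ord0 ord0; have a0 : a != 0 by apply: Md.
pose D := \matrix_(i < n, j < n) (M (l i) (l j) - M (l i) ord0 * a^-1 * M ord0 (l j)).
(* A nonzero correction term needs [sigma (l j) < sigma ord0 < sigma (l i)], so transitivity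
   preserves the support. *)
have Ds i j : i != j -> ~~ (sigma (l j) < sigma (l i))%N -> D i j = 0.
  move=> ij sij; rewrite mxE Ms ?(inj_eq lift_inj) //.
  have [s0|s0] := boolP (sigma ord0 < sigma (l i))%N.
    rewrite (Ms ord0) ?mulr0 ?subrr //; lia.
  by rewrite (Ms (l i) ord0) // !mul0r subrr.
(* On the diagonal the two factors of the correction cannot both be nonzero, by asymmetry of the
   order; so all pivots are the original diagonal entries. *)
have Dd i : D i i = M (l i) (l i).
  rewrite mxE; have [s0|s0] := boolP (sigma ord0 < sigma (l i))%N.
    by rewrite (Ms ord0) ?mulr0 ?subr0 //; lia.
  by rewrite (Ms (l i) ord0) // !mul0r subr0.
have [|L [U [DE /is_trig_mxP Lt /is_trig_mxP Ut [Ld Ud LUs]]]] :=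
  IH (sigma \o l) D _ Ds.
  by move=> i; rewrite Dd.
pose L' : 'M[F]_n.+1 := \matrix_(i, j)
  if unlift ord0 j is Some j' then
    if unlift ord0 i is Some i' then L i' j' else 0
  else M i ord0.
pose U' : 'M[F]_n.+1 := \matrix_(i, j)
  if unlift ord0 i is Some i' then
    if unlift ord0 j is Some j' then U i' j' else 0
  else a^-1 * M ord0 j.
exists L', U'; split.
- apply/matrixP => i j; rewrite mxE big_ord_recl /= !mxE unlift_none.
  under eq_bigr => k _ do rewrite !mxE liftK.
  have [i' ->|->] := unliftP ord0 i; last first.
    by rewrite big1 ?addr0 ?mulrA ?divff ?mul1r // => k _; rewrite mul0r.
  have [j' ->|->] := unliftP ord0 j; last first.
    by rewrite big1 ?addr0 ?mulVf ?mulr1 // => k _; rewrite mulr0.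
  have := congr1 (fun A : 'M[F]_n => A i' j') DE; rewrite !mxE => <-.
  by rewrite -/(l i') -/(l j') mulrA addrC subrK.
- apply/is_trig_mxP => i j; rewrite mxE.
  have [j' ->|->] := unliftP ord0 j; last by rewrite ltn0.
  have [i' ->|->] := unliftP ord0 i => //.
  by rewrite !lift0 ltnS; apply: Lt.
- apply/is_trig_mxP => i j; rewrite !mxE.
  have [j' ->|->] := unliftP ord0 j; last by rewrite ltn0.
  have [i' ->|->] := unliftP ord0 i => //.
  by rewrite !lift0 ltnS => /Ut; rewrite mxE.
split=> [i|i|i j ij sij]; rewrite !mxE.
- by case: unliftP => [i' ->|->]; rewrite ?Ld ?Dd.
- by case: unliftP => [i' _|->]; rewrite ?Ud ?mulVf.
have [j' ej|ej] := unliftP ord0 j; have [i' ei|ei] := unliftP ord0 i.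
- by apply: LUs; [move: ij; rewrite ei ej (inj_eq lift_inj) | rewrite /= /l -ei -ej].
- by split=> //; rewrite Ms ?mulr0 // -?ei.
- by split=> //; rewrite Ms // -?ej.
by rewrite ei ej eqxx in ij.
Qed.

(** * Parabolic subgroups *)

(** For elementary matrices this is the commutator relation that produces the root subgroup of a sum
    of two roots. *)
Lemma commutator_left (R : pzRingType) (x y : R) : x * x = 0 -> y * x = 0 ->
  y * y = 0 ->
  (1 + x) * (1 + y) * (1 - x) * (1 - y) = 1 + x * y.
Proof.
move=> xx yx yy.
have -> : (1 + x) * (1 + y) * (1 - x) = 1 + y + x * y.
  rewrite mulrBr mulr1 -mulrA [(1 + y) * x]mulrDl mul1r yx addr0.
  by rewrite !mulrDl !mulrDr !mul1r mulr1 xx addr0 [x + _]addrC addrA addrK.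
rewrite mulrBr mulr1 !mulrDl mul1r -mulrA yy mulr0 !addr0.
by rewrite addrAC addrK.
Qed.

Lemma commutator_right (R : pzRingType) (x y : R) : x * x = 0 -> x * y = 0 ->
  y * y = 0 ->
  (1 - y) * ((1 - x) * (1 + y) * (1 + x)) = 1 + y * x.
Proof.
move=> xx xy yy.
have -> : (1 - x) * (1 + y) * (1 + x) = 1 + y + y * x.
  have -> : (1 - x) * (1 + y) = 1 + y - x by rewrite mulrBl mul1r mulrDr mulr1 xy addr0.
  by rewrite mulrDr mulr1 mulrBl mulrDl xx subr0 mul1r [1 + y - x + _]addrA subrK.
rewrite mulrBl mul1r !mulrDr mulr1 mulrA yy mul0r !addr0.
by rewrite addrAC addrK.
Qed.

Section Parabolic.
Variables (F : fieldType) (n : nat) (P : set 'M[F]_n) (m : nat).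
Hypothesis PG : subgroup P.
Hypothesis BP : forall b, Bminus F n b -> P b.

Let Pmul a b : P a -> P b -> P (a *m b).
Proof. by case: PG => _ _ H _; apply: H. Qed.

Let Pinv a : P a -> P (invmx a).
Proof. by case: PG => _ _ _; apply. Qed.

Definition elem (i d : 'I_n) (c : F) : 'M[F]_n := 1%:M + c *: delta_mx i d.

Lemma elem_lower (i d : 'I_n) c : (d < i)%N -> Bminus F n (elem i d c).
Proof.
move=> di; have id' : (i == d) = false by rewrite -val_eqE /= gtn_eqF.
apply: Bminus_intro => a; [move=> b ab|]; rewrite !mxE.
  rewrite -val_eqE /= ltn_eqF // (_ : (a == i) && (b == d) = false) ?mulr0 ?addr0 //.
  by apply/negP => /andP[/eqP e1 /eqP e2]; move: ab; rewrite e1 e2; lia.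
rewrite eqxx (_ : (a == i) && (a == d) = false) ?mulr0 ?addr0 ?oner_eq0 //.
by apply/negP => /andP[/eqP -> ]; rewrite id'.
Qed.

Lemma elemN (i d : 'I_n) c : elem i d (- c) = 1%:M - c *: delta_mx i d.
Proof. by rewrite /elem scaleNr. Qed.

Let sqr0 (i d : 'I_n) c : (i < d)%N || (d < i)%N ->
  (c *: delta_mx i d) *m (c *: delta_mx i d) = 0 :> 'M[F]_n.
Proof.
move=> id'; rewrite -scalemxAl -scalemxAr mul_delta_mx_0 ?scaler0 //.
by rewrite -val_eqE /=; lia.
Qed.

(** Commuting with a lower elementary matrix moves the row of a root subgroup down; [elem_col] moves
    the column left. Starting anywhere across the cut [m], both together reach the simple root at
    [m]. *)
Lemma elem_row (i k d : 'I_n) : (k < i)%N -> (i < d)%N ->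
  (forall c, P (elem k d c)) -> forall c, P (elem i d c).
Proof.
move=> ki di Pkd c.
have -> : elem i d c =
    elem i k 1 *m elem k d c *m elem i k (- 1) *m elem k d (- c).
  rewrite !elemN -[RHS]/((1 + 1 *: delta_mx i k) * (1 + c *: delta_mx k d) *
    (1 - 1 *: delta_mx i k) * (1 - c *: delta_mx k d)) commutator_left.
  - by rewrite -[_ * _]/(_ *m _) -scalemxAl -scalemxAr mul_delta_mx scale1r.
  - by apply: sqr0; rewrite ki orbT.
  - rewrite -[LHS]/(_ *m _) -scalemxAl -scalemxAr mul_delta_mx_0 ?scaler0 //.
    by rewrite -val_eqE /=; lia.
  by apply: sqr0; rewrite (ltn_trans ki).
by do ! apply: Pmul; rewrite ?Pkd //; apply/BP/elem_lower.
Qed.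

Lemma elem_col (i k d : 'I_n) : (k < d)%N -> (i < k)%N ->
  (forall c, P (elem i d c)) -> forall c, P (elem i k c).
Proof.
move=> kd ik Pid c.
have -> : elem i k c =
    elem i d (- c) *m (elem d k (- 1) *m elem i d c *m elem d k 1).
  rewrite !elemN -[RHS]/((1 - c *: delta_mx i d) * ((1 - 1 *: delta_mx d k) *
     (1 + c *: delta_mx i d) * (1 + 1 *: delta_mx d k))) commutator_right.
  - by rewrite -[_ * _]/(_ *m _) -scalemxAl -scalemxAr mul_delta_mx scale1r.
  - by apply: sqr0; rewrite kd orbT.
  - rewrite -[LHS]/(_ *m _) -scalemxAl -scalemxAr mul_delta_mx_0 ?scaler0 //.
    by rewrite -val_eqE /=; lia.
  by apply: sqr0; rewrite (ltn_trans ik).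
by do ! apply: Pmul; rewrite ?Pid //; apply/BP/elem_lower.
Qed.

Lemma elem_sdot (i d : 'I_n) : (0 < m < n)%N -> (i < m)%N -> (m <= d)%N ->
  (forall c, P (elem i d c)) -> P (sdot F n m).
Proof.
move=> mn im md Pid.
have i0n : (m.-1 < n)%N by lia.
have d0n : (m < n)%N by lia.
pose i0 := Ordinal i0n; pose d0 := Ordinal d0n.
have P1 c : P (elem i0 d c).
  have [/eqP e|ne] := boolP (i == i0 :> nat); first by rewrite -(val_inj e).
  apply: (elem_row (k := i)) => //=; [move: ne; rewrite /=; lia|lia].
have P2 c : P (elem i0 d0 c).
  have [/eqP e|ne] := boolP (d == d0 :> nat); first by rewrite -(val_inj e).
  apply: (elem_col (d := d)) => //=; [move: ne; rewrite /=; lia|lia].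
have i0d0 : (i0 == d0) = false by rewrite -val_eqE /=; lia.
have d0i0 : (d0 == i0) = false by rewrite eq_sym.
rewrite /sdot (@Eunit_delta _ _ m m.+1 i0 d0) ?(@Eunit_delta _ _ m.+1 m d0 i0) //=
  ?prednK; try lia.
rewrite !expN_square0 ?mulmxN ?mulNmx ?mul_delta_mx_0 ?oppr0 ?i0d0 ?d0i0 //; try lia.
rewrite -[delta_mx i0 d0]scale1r -[delta_mx d0 i0]scale1r -scaleNr -!/(elem _ _ _).
do ! apply: Pmul; rewrite ?P2 //; apply/BP/elem_lower => /=; lia.
Qed.

(* Lower unipotent row and column operations clear everything but the first
   nonzero entry of [v] and the last nonzero entry of [w]. *)
Lemma rank1_elem (v : 'cV[F]_n) (w : 'rV[F]_n) (i1 d1 : 'I_n) :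
    w *m v = 0 -> (i1 < m)%N -> (m <= d1)%N -> v i1 0 != 0 -> w 0 d1 != 0 ->
    (forall c, P (1%:M + c *: (v *m w))) ->
  exists i d : 'I_n, [/\ (i < m)%N, (m <= d)%N & forall c, P (elem i d c)].
Proof.
move=> wv im1 md1 vi1 wd1 Pvw.
case: (@arg_minnP _ i1 (fun i => v i 0 != 0) val vi1) => i vi imin.
case: (@arg_maxnP _ d1 (fun d => w 0 d != 0) val wd1) => d wd dmax.
have im : (i < m)%N by apply: leq_ltn_trans im1; apply: imin.
have md : (m <= d)%N by apply: leq_trans md1 _; apply: dmax.
have v0 (k : 'I_n) : (k < i)%N -> v k 0 = 0.
  by move=> ki; apply: contraTeq ki => /imin; rewrite -leqNgt.
have w0 (k : 'I_n) : (d < k)%N -> w 0 k = 0.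
  by move=> ki; apply: contraTeq ki => /dmax; rewrite -leqNgt.
exists i, d; split => // c.
pose u : 'cV[F]_n := \col_k (if (i < k)%N then v k 0 / v i 0 else 0).
pose ei : 'rV[F]_n := delta_mx 0 i.
pose ed : 'cV[F]_n := delta_mx d 0.
pose s : 'rV[F]_n := \row_k (if (k < d)%N && (k != i) then w 0 k / w 0 d else 0).
have eiE (y : 'cV[F]_n) : ei *m y = (y i 0)%:M.
  apply/matrixP => a b; rewrite !ord1 !mxE (bigD1 i) //= big1 ?addr0.
    by rewrite mxE !eqxx mul1r mulr1n.
  by move=> k ki; rewrite mxE (negPf ki) andbF mul0r.
have edE (y : 'rV[F]_n) : y *m ed = (y 0 d)%:M.
  apply/matrixP => a b; rewrite !ord1 !mxE (bigD1 d) //= big1 ?addr0.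
    by rewrite mxE !eqxx mulr1 mulr1n.
  by move=> k kd; rewrite mxE (negPf kd) mulr0.
have vE : v = v i 0 *: (u + ei^T).
  apply/colP => k; rewrite !mxE.
  have [->|ki] := eqVneq k i; first by rewrite ltnn eqxx add0r mulr1.
  rewrite andbF addr0; case: ltnP => ik; first by rewrite mulrCA divff // mulr1.
  by rewrite mulr0 v0 // ltn_neqAle ik andbT.
(* Since [w *m v = 0], the conjugation clearing [v] below [i] also cancels the entry of [w] at [i].
   Therefore [s] omits [i], and the second conjugation does not disturb the cleared column. *)
have wu : w *m u = (- w 0 i)%:M.
  have : w *m (u + ei^T) = 0.
    by apply: (scalerI vi); rewrite scaler0 scalemxAr -vE.
  rewrite mulmxDr => /eqP; rewrite addr_eq0 => /eqP ->.
  by rewrite -[w *m _]trmxK trmx_mul trmxK eiE tr_scalar_mx mxE raddfN.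
have ui : u i 0 = 0 by rewrite mxE ltnn.
have sd : s 0 d = 0 by rewrite mxE ltnn.
have si : s 0 i = 0 by rewrite mxE eqxx andbF.
have wE : w - w 0 i *: ei = w 0 d *: (s + ed^T).
  apply/rowP => k; rewrite !mxE eqxx /= andbT.
  have [->|ki] := eqVneq k i.
    rewrite andbF mulr1 subrr (_ : (i == d) = false) ?addr0 ?mulr0 //.
    by rewrite -val_eqE /=; lia.
  rewrite mulr0 subr0 andbT; have [->|kd] := eqVneq k d.
    by rewrite ltnn add0r mulr1.
  rewrite addr0; case: ltnP => dk; first by rewrite mulrCA divff // mulr1.
  by rewrite mulr0 w0 // ltn_neqAle eq_sym dk andbT.
have Bx e : Bminus F n (1%:M + e *: (u *m ei)).
  apply: Bminus_intro => a; [move=> b ab|]; rewrite !mxE big_ord1 !mxE.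
    rewrite -val_eqE /= ltn_eqF // add0r.
    have [bi|bi] := eqVneq b i; last by rewrite !mulr0.
    by rewrite ifF ?mul0r ?mulr0 // -bi; lia.
  have [ai|ai] := eqVneq a i; last by rewrite eqxx !mulr0 addr0 oner_eq0.
  by rewrite ai ltnn mul0r mulr0 eqxx addr0 oner_eq0.
have By e : Bminus F n (1%:M + e *: (ed *m s)).
  apply: Bminus_intro => a; [move=> b ab|]; rewrite !mxE big_ord1 !mxE.
    rewrite -val_eqE /= ltn_eqF // add0r.
    have [ad|ad] := eqVneq a d; last by rewrite mul0r mulr0.
    by rewrite ifF ?mulr0 //; apply/negP => /andP[]; rewrite -ad; lia.
  have [ad|ad] := eqVneq a d; last by rewrite eqxx mul0r mulr0 addr0 oner_eq0.
  by rewrite ad ltnn /= !mulr0 eqxx addr0 oner_eq0.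
pose x := 1%:M + (-1) *: (u *m ei); pose x' := 1%:M + 1 *: (u *m ei).
pose y := 1%:M + 1 *: (ed *m s); pose y' := 1%:M + (-1) *: (ed *m s).
have xx' : x *m x' = 1%:M.
  rewrite /x /x' scale1r scaleN1r mulmxBl mul1mx mulmxDr mulmx1.
  by rewrite mulmxA -[_ *m ei *m u]mulmxA eiE ui mul_mx_scalar scale0r mul0mx addr0
    addrK.
have yy' : y *m y' = 1%:M.
  rewrite /y /y' scale1r scaleN1r mulmxDl mul1mx mulmxBr mulmx1.
  by rewrite mulmxA -[_ *m s *m ed]mulmxA edE sd mul_mx_scalar scale0r mul0mx subr0
    subrK.
have xv : x *m v = v i 0 *: ei^T.
  rewrite {1}vE -scalemxAr; congr (_ *: _).
  rewrite /x scaleN1r mulmxBl mul1mx -mulmxA mulmxDr eiE ui.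
  by rewrite eiE !mxE !eqxx mulmxDr !mul_mx_scalar scale0r scale1r add0r addrAC
    subrr add0r.
have yei : y *m ei^T = ei^T.
  rewrite /y scale1r mulmxDl mul1mx -mulmxA.
  by rewrite -[s *m _]trmxK trmx_mul trmxK eiE mxE si tr_scalar_mx mul_mx_scalar
    scale0r addr0.
have wx' : w *m x' = w 0 d *: (s + ed^T).
  by rewrite /x' scale1r mulmxDr mulmx1 mulmxA wu mul_scalar_mx scaleNr wE.
have sy' : (s + ed^T) *m y' = ed^T.
  rewrite /y' scaleN1r mulmxBr mulmx1 mulmxA mulmxDl edE sd edE !mxE !eqxx.
  by rewrite mulmxDl !mul_scalar_mx scale0r scale1r add0r addrAC subrr add0r.
have conj1 (X X' M : 'M[F]_n) : X *m X' = 1%:M ->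
    X *m (1%:M + M) *m X' = 1%:M + X *m M *m X'.
  by move=> e; rewrite mulmxDr mulmx1 mulmxDl e.
have -> : elem i d c =
    y *m x *m (1%:M + (c / (v i 0 * w 0 d)) *: (v *m w)) *m (x' *m y').
  rewrite conj1; last by rewrite mulmxA -[y *m x *m x']mulmxA xx' mulmx1 yy'.
  rewrite /elem; congr (_ + _); rewrite -!scalemxAr -!scalemxAl.
  have -> : y *m x *m (v *m w) *m (x' *m y') = (y *m (x *m v)) *m (w *m x' *m y').
    by rewrite !mulmxA.
  rewrite xv wx' -scalemxAr yei -!scalemxAl sy' -!scalemxAr !scalerA.
  rewrite -trmx_mul /ei /ed mul_delta_mx trmx_delta.
  by congr (_ *: _); field; rewrite vi wd.
have Px e := BP (Bx e); have Py e := BP (By e).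
by apply: (Pmul (Pmul (Pmul (Py _) (Px _)) (Pvw _)) (Pmul (Px _) (Py _))).
Qed.

(** If [p] has an entry across the cut, so does its inverse. Conjugating a suitable lower elementary
    matrix by [p] gives [1 + c v w] with [v] a column of [invmx p] and [w] a row of [p], both
    reaching across, and [rank1_elem] extracts a root subgroup. *)
Lemma parabolic_block_lower : (0 < m < n)%N -> ~ P (sdot F n m) ->
  forall p, P p -> block_lower m p.
Proof.
move=> mn nPs p Pp; have pu : p \in unitmx by case: PG => + _ _ _; apply.
have [//|] := pselect (block_lower m p) => nbl; exfalso; apply: nPs.
have nbl' : ~ block_lower m (invmx p).
  move=> H; apply: nbl; rewrite -[p]invmxK; apply: block_lower_inv H.
  by rewrite unitmx_inv.
have wit (A : 'M[F]_n) : ~ block_lower m A -> exists a b : 'I_n, [/\ (a < m)%N,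
  (m <= b)%N & A a b != 0].
  move=> H; apply: contrapT => H'; apply: H => a b am mb.
  by apply/eqP/negPn/negP => ab; apply: H'; exists a, b.
have [a [b [am mb pab]]] := wit _ nbl; have [i [k [im mk pik]]] := wit _ nbl'.
have [||||||i' [d' [im' md' Pe]]] := @rank1_elem (col k (invmx p)) (row a p) i b.
(* The product of row [a] of [p] and column [k] of its inverse is an off-diagonal entry of the
   identity. *)
- apply/matrixP => x y; have := congr1 (fun A : 'M_n => A a k) (mulmxV pu).
  rewrite !mxE -val_eqE /= ltn_eqF ?(leq_trans am) // => e; rewrite -[RHS]e.
  by apply: eq_bigr => z _; rewrite !mxE.
- by [].
- by [].
- by rewrite mxE.
- by rewrite mxE.
- move=> c; have -> : 1%:M + c *: (col k (invmx p) *m row a p) =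
     invmx p *m elem k a c *m p.
    rewrite /elem mulmxDr mulmxDl mulmx1 mulVmx // -scalemxAr -scalemxAl;
      congr (_ + _ *: _).
    by rewrite colE rowE !mulmxA -[_ *m delta_mx k 0 *m _]mulmxA mul_delta_mx.
  apply: Pmul => //; apply: Pmul; first exact: Pinv.
  by apply/BP/elem_lower/(leq_trans am).
exact: (elem_sdot mn im' md').
Qed.

End Parabolic.

(** * Coset representatives *)

Section Conjugation.
Variables (F : fieldType) (n : nat) (s : 'I_n -> nat) (w : 'S_n).
Notation W := (signed_perm F s w).

Lemma mul_signed_permTE m (A : 'M[F]_(m, n)) a b :
  (A *m W^T) a b = A a (w b) * (-1) ^+ s b.
Proof. by rewrite -[A *m _]trmxK trmx_mul trmxK mxE signed_perm_mulE mxE mulrC. Qed.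

Lemma signed_permT_mulE m (A : 'M[F]_(n, m)) a b :
  (W^T *m A) (w a) b = (-1) ^+ s a * A a b.
Proof. by rewrite -[W^T *m _]trmxK trmx_mul trmxK mxE mul_signed_permE mxE mulrC. Qed.

Lemma signed_perm_conjE (A : 'M[F]_n) a b :
  (W *m A *m W^T) a b = (-1) ^+ s a * A (w a) (w b) * (-1) ^+ s b.
Proof. by rewrite mul_signed_permTE signed_perm_mulE. Qed.

Lemma signed_perm_conjVE (A : 'M[F]_n) a b :
  (W^T *m A *m W) (w a) (w b) = (-1) ^+ s a * A a b * (-1) ^+ s b.
Proof. by rewrite mul_signed_permE signed_permT_mulE. Qed.

End Conjugation.

Section Cosets.
Variables (F : fieldType) (n : nat).
Implicit Types (A : set 'M[F]_n) (g z : 'M[F]_n).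

Lemma right_cosetP A g x : right_coset A g x <-> exists2 a, A a & x = a *m g.
Proof.
by split=> [[a Aa [_ -> <-]]|[a Aa ->]]; exists a => //; exists g.
Qed.

Lemma left_cosetP A g x : left_coset g A x <-> exists2 a, A a & x = g *m a.
Proof.
by split=> [[_ -> [a Aa <-]]|[a Aa ->]]; [exists a | exists g => //; exists a].
Qed.

Lemma left_coset_Bplus z c : Bplus F n c ->
  left_coset (z *m c) (Bplus F n) = left_coset z (Bplus F n).
Proof.
move=> cB; apply/seteqP; split => x /left_cosetP[a aB ->]; apply/left_cosetP.
  by exists (c *m a); rewrite ?mulmxA //; apply: Bplus_mul.
exists (invmx c *m a); first by apply: Bplus_mul => //; apply: Bplus_inv.
by rewrite mulmxA mulmxK //; case: cB.
Qed.

Lemma Bplus1 : Bplus F n 1%:M.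
Proof. by apply/Bplus_tr; rewrite trmx1; apply: Bminus1. Qed.

Lemma left_coset_eqP z z' : left_coset z (Bplus F n) = left_coset z' (Bplus F n) ->
  exists2 c, Bplus F n c & z = z' *m c.
Proof.
move=> e; have : left_coset z (Bplus F n) z.
  by apply/left_cosetP; exists 1%:M; [apply: Bplus1 | rewrite mulmx1].
by rewrite e => /left_cosetP.
Qed.

Lemma right_coset_self A g : subgroup A -> right_coset A g g.
Proof. by case=> _ A1 _ _; apply/right_cosetP; exists 1%:M; rewrite ?mul1mx. Qed.

End Cosets.

(** * Representatives in [Zcal] and surjectivity of psi *)

Section Construction.
Variables (F : fieldType) (n : nat) (ns : seq nat).
Hypothesis nsP : is_IP n ns.
Notation N := (nn n ns).
Notation r := (size ns).
Notation blk := (block_of n ns).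
Notation hat := (pivot_col n ns).
Notation sg := (fun a => nn n ns (block_of n ns (nat_of_ord a))).
Notation sigma := (pivot_perm n ns).
Notation W := (signed_perm F (fun a : 'I_n => nn n ns (block_of n ns a))
  (pivot_perm n ns)).

Let sgsg (k : nat) (x : F) : (-1) ^+ k * x * (-1) ^+ k = x.
Proof. by rewrite mulrAC -expr2 sqrr_sign mul1r. Qed.

Let WE : wPw0 F n ns = W := wPw0E nsP F.

Let WT : W *m W^T = 1%:M := signed_perm_mulT _ _ _.

Lemma ZcalP z : Zcal ns z <->
  [/\ exists2 u, Uplus F n u & z = u *m W, exists2 v, Uminus F n v & z = W *m v
    & mulset (Bminus F n) (Bplus F n) z].
Proof.
split=> [[[[u uU [_ -> <-]] [_ -> [v vU e]]] zB]|[[u uU e] [v vU e'] zB]].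
  by split=> //; [exists u | exists v]; rewrite -?WE.
split=> //; split.
  by exists u => //; exists (wPw0 F n ns); rewrite ?WE.
by exists (wPw0 F n ns) => //; exists v; rewrite ?WE.
Qed.

(** The support condition on [u] says that conjugation by W makes it lower triangular, which is the
    form in which LU decompositions provide it. *)
Lemma Zcal_intro (u z : 'M[F]_n) : Uplus F n u -> z = u *m W ->
    (forall a b, a != b -> ~~ (sigma b < sigma a)%N -> u a b = 0) ->
    mulset (Bminus F n) (Bplus F n) z -> Zcal ns z.
Proof.
move=> uU zE us zB; apply/ZcalP; split=> //; first by exists u.
have zE' : z = W *m (W^T *m u *m W) by rewrite !mulmxA WT mul1mx.
exists (W^T *m u *m W) => //.
have u1 a : (W^T *m u *m W) a a = 1.
  by rewrite -[a](permKV sigma) signed_perm_conjVE sgsg; case: uU.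
split=> //; apply: Bminus_intro => [a b ab|a]; last by rewrite u1 oner_eq0.
rewrite -[a](permKV sigma) -[b](permKV sigma) signed_perm_conjVE us ?mulr0 ?mul0r //.
  by rewrite (inj_eq perm_inj) -val_eqE /= ltn_eqF.
by rewrite !permKV -leqNgt ltnW.
Qed.

(** The dotted representative of the same permutation differs from W only by signs, and the diagonal
    sign matrix is absorbed by [B_-]. *)
Lemma dotw_Richardson_diag : exists2 D, Bminus F n D &
  dotw F (w0 n * wP n ns)^-1%g = D *m W.
Proof.
exists (\matrix_(a, b) ((-1) ^+ (inv_at sigma a + N (blk a)) *+ (a == b))).
  apply: Bminus_intro => [a b ab|a]; rewrite mxE.
    by rewrite -val_eqE /= ltn_eqF.
  by rewrite eqxx signr_eq0.
rewrite dotw_RichardsonE; apply/matrixP => a b.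
rewrite diag_matrix_mul !mxE mulrnAr; congr (_ *+ _).
by rewrite exprD -mulrA -expr2 sqrr_sign mulr1.
Qed.

(** Write a representative as [b1 D W b3]. The matrix W [b3] W^-1 is supported on the order given by
    [sigma]; its lower factor joins [b1 D] in [B_-], and its upper factor times W is the required
    [z]. *)
Lemma Zcal_of_PGcirc (P : set 'M[F]_n) X : subgroup P ->
    (forall b, Bminus F n b -> P b) -> PGcirc ns P X ->
  exists2 z, Zcal ns z & X = right_coset P z.
Proof.
move=> PG BP [Y [[g1 [b bB [c cB <-]] YE1] [g2 [_ [b1 b1B [_ ->
  <-]] [b3 b3B g2E]] YE2]] <-].
have [b2 b2B g2E'] : exists2 b2, Bminus F n b2 & g2 = b2 *m (b *m c).
  apply/right_cosetP; rewrite YE1 -YE2; apply/right_cosetP; exists 1%:M.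
    exact: Bminus1.
  by rewrite mul1mx.
have [D DB DE] := dotw_Richardson_diag.
pose M := W *m b3 *m W^T.
have [|a a' ne lt|L [U [MLU Lt Ut [Ld Ud LUs]]]] :=
  @ordered_LU F n (fun a => sigma a) M.
- by move=> a; rewrite signed_perm_conjE sgsg (Bminus_diag _ b3B).
- rewrite signed_perm_conjE (Bminus0 b3B) ?mulr0 ?mul0r //.
  rewrite ltn_neqAle leqNgt lt andbT; apply: contra ne => /eqP /val_inj/perm_inj ->.
  exact: eqxx.
have LB : Bminus F n L.
  apply: Bminus_intro => [a a' aa'|a]; first by move/is_trig_mxP: Lt => ->.
  by rewrite Ld signed_perm_conjE sgsg (Bminus_diag _ b3B).
have UU : Uplus F n U.
  split=> //; apply: Bplus_intro => [a a' aa'|a]; last by rewrite Ud oner_eq0.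
  by move/is_trig_mxP: Ut => /(_ _ _ aa'); rewrite mxE.
pose l := b1 *m D *m L.
have lB : Bminus F n l by do ! apply: Bminus_mul.
have g2l : g2 = l *m (U *m W).
  have -> : l *m (U *m W) = b1 *m D *m (L *m U) *m W by rewrite /l !mulmxA.
  by rewrite -MLU -g2E DE /M -!mulmxA (mulmx1C WT) mulmx1.
clearbody l.
have lu : l \in unitmx by case: lB.
have Pm a b' : P a -> P b' -> P (a *m b') by case: PG => _ _ H _; apply: H.
exists (U *m W).
  apply: (Zcal_intro UU) => // [a a' ne lt|]; first by case: (LUs a a' ne lt).
  exists (invmx l *m b2 *m b); first by do ! apply: Bminus_mul => //; apply: Bminus_inv.
  by exists c => //; rewrite -!mulmxA -g2E' g2l mulKmx.
apply/seteqP; split=> x.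
  case=> p Pp [y]; rewrite -YE2 => /right_cosetP[b' b'B ->] <-.
  apply/right_cosetP; exists (p *m b' *m l); last by rewrite g2l !mulmxA.
  exact: (Pm _ _ (Pm _ _ Pp (BP _ b'B)) (BP _ lB)).
case/right_cosetP => p Pp ->; exists (p *m invmx l).
  exact: (Pm _ _ Pp (BP _ (Bminus_inv lB))).
exists (l *m (U *m W)); last by rewrite !mulmxA mulmxKV.
rewrite -YE2 g2l; apply/right_cosetP.
by exists 1%:M; rewrite ?mul1mx //; apply: Bminus1.
Qed.

Lemma ZP_factorisation b : ZP ns b -> exists u1 t u2,
  [/\ factorisation ns b = (u1, t, u2), Uplus F n u1, torusWP ns t, Uplus F n u2 &
      b = u1 *m t *m W *m u2].
Proof.
move=> [_ [_ [_ [u1 u1U [t tT <-]] [_ -> <-]] [u2 u2U bE]]].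
have := @xgetPex _ (0, 0, 0) [set x : 'M[F]_n * 'M[F]_n * 'M[F]_n |
  [/\ Uplus F n x.1.1, torusWP ns x.1.2, Uplus F n x.2
    & b = x.1.1 *m x.1.2 *m wPw0 F n ns *m x.2]]%classic.
rewrite -/(factorisation ns b); case E: (factorisation ns b) => [[v1 t'] v2] /= H.
have [v1U t'T v2U e] := H (ex_intro _ (u1, t, u2) (And4 u1U tT u2U (esym bE))).
by exists v1, t', v2; split=> //; rewrite -WE.
Qed.

Lemma torus_matrix t : torus F n t -> exists2 d : 'I_n -> F, (forall a, d a != 0) &
  t = \matrix_(a, b) (d a *+ (a == b)).
Proof.
move=> [tu /is_diag_mxP td]; exists (fun a => t a a) => [a|].
  apply: (@Bminus_diag _ _ t); split=> //; apply/is_trig_mxP => x y xy.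
  by rewrite td // ltn_eqF.
apply/matrixP => a b; rewrite mxE; case: (a =P b) => [->|/eqP ab] //.
by rewrite td.
Qed.

Lemma torus_Bminus t : torus F n t -> Bminus F n t.
Proof.
move=> [tu /is_diag_mxP td]; split=> //; apply/is_trig_mxP => x y xy.
by rewrite td // ltn_eqF.
Qed.

Lemma torus_conj_Uplus t u : torus F n t -> Uplus F n u ->
  Uplus F n (invmx t *m u *m t) /\
  forall a b, (invmx t *m u *m t) a b = (t a a)^-1 * u a b * t b b.
Proof.
move=> tT [uB u1]; have [d d0 tE] := torus_matrix tT.
have tu : t \in unitmx by case: tT.
have iE : invmx t = \matrix_(a, b) ((d a)^-1 *+ (a == b)).
  rewrite -[RHS](mulKmx tu); suff -> : t *m (\matrix_(a,
    b) ((d a)^-1 *+ (a == b))) = 1%:M.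
    by rewrite mulmx1.
  apply/matrixP => a b; rewrite tE diag_matrix_mul !mxE mulrnAr.
  by case: (a =P b) => [->|//]; rewrite divff.
have E a b : (invmx t *m u *m t) a b = (t a a)^-1 * u a b * t b b.
  by rewrite [X in _ *m X]tE mul_diag_matrix iE diag_matrix_mul tE !mxE !eqxx.
split=> //; split=> [|a]; last by rewrite E u1 mulr1 mulVf // tE mxE eqxx mulr1n.
apply: Bplus_intro => [a b ba|a]; rewrite E;
  first by rewrite (Bplus0 uB) // mulr0 mul0r.
by rewrite u1 mulr1 mulVf ?oner_eq0 // tE mxE eqxx mulr1n.
Qed.

(** After moving the unipotent factors apart, the entry at [(a, sigma a)] sees only the diagonals,
    which are [1] for the unipotent parts. *)
Lemma torus_unique u1 t u2 v1 t' v2 :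
    Uplus F n u1 -> torus F n t -> Uplus F n u2 ->
    Uplus F n v1 -> torus F n t' -> Uplus F n v2 ->
  u1 *m t *m W *m u2 = v1 *m t' *m W *m v2 -> t = t'.
Proof.
move=> u1U tT u2U v1U t'T v2U e.
have [d d0 tE] := torus_matrix tT; have [d' d'0 tE'] := torus_matrix t'T.
have v1u : v1 \in unitmx by case: v1U => -[].
have u2u : u2 \in unitmx by case: u2U => -[].
have {}e : invmx v1 *m u1 *m t *m W = t' *m (W *m (v2 *m invmx u2)).
  apply: (can_inj (mulmxK u2u)); apply: (can_inj (mulKmx v1u)).
  by rewrite !mulmxA mulmxKV // mulmxV // mul1mx e.
have [_ A1] := Uplus_mul (Uplus_inv v1U) u1U.
have [_ B1] := Uplus_mul v2U (Uplus_inv u2U).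
apply/matrixP => a b; rewrite tE tE' !mxE; congr (_ *+ _).
have := congr1 (fun A : 'M_n => A a (sigma a)) e.
rewrite mul_signed_permE tE mul_diag_matrix A1 mul1r tE' diag_matrix_mul.
rewrite signed_perm_mulE B1 mulr1; by apply: mulIf; rewrite signr_eq0.
Qed.

(** Factor W^-1 [u] W as [L *m U]. Then [u W u2 = W L (U u2)] with [U u2] in [U_+], so [W L] lies in
    the same coset. *)
Lemma Zcal_exists u u2 : Uplus F n u -> Uplus F n u2 -> Bminus F n (u *m W *m u2) ->
  exists2 z, Zcal ns z &
    left_coset z (Bplus F n) = left_coset (u *m W *m u2) (Bplus F n).
Proof.
move=> uU u2U bB; have [uB u1] := uU.
pose M := W^T *m u *m W.
have ME a b : M (sigma a) (sigma b) = (-1) ^+ N (blk a) * u a b * (-1) ^+ N (blk b).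
  exact: signed_perm_conjVE.
have M1 a : M a a = 1 by rewrite -[a](permKV sigma) ME u1 sgsg.
(* The weight decreases with the row number because [u] is upper triangular, while [ordered_LU] asks
   for smaller weights at the columns. *)
have [|a a' ne lt|L [U [MLU Lt Ut [Ld Ud LUs]]]] :=
    @ordered_LU F n (fun a => n - (sigma^-1 a)%g)%N M.
- by move=> a; rewrite M1 oner_eq0.
- rewrite -[a](permKV sigma) -[a'](permKV sigma) ME (Bplus0 uB) ?mulr0 ?mul0r //.
  move: lt; rewrite -leqNgt => lt; have : (sigma^-1 a != sigma^-1 a')%g by rewrite
    (inj_eq perm_inj).
  rewrite -val_eqE /=; have := ltn_ord (sigma^-1 a)%g; have :=
    ltn_ord (sigma^-1 a')%g; lia.
have UU : Uplus F n U.
  split=> //; apply: Bplus_intro => [a a' aa'|a]; last by rewrite Ud oner_eq0.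
  by move/is_trig_mxP: Ut => /(_ _ _ aa'); rewrite mxE.
have Uu2 := (Uplus_mul UU u2U).
have bE : u *m W *m u2 = W *m L *m (U *m u2).
  by rewrite mulmxA -[W *m L *m U]mulmxA -MLU /M !mulmxA WT mul1mx.
have [Uu2B _] := Uu2.
exists (W *m L); last by rewrite bE (left_coset_Bplus _ Uu2B).
have E a b : (W *m L *m W^T) a b = (-1) ^+ N (blk a) * L (sigma a) (sigma b) * (-1)
  ^+ N (blk b).
  exact: signed_perm_conjE.
have Ls (a b : 'I_n) : a != b -> ~~ (a < b)%N -> L (sigma a) (sigma b) = 0.
  move=> ab lt; have [||-> //] := LUs (sigma a) (sigma b);
    rewrite ?(inj_eq perm_inj) ?permK //.
  by have := ltn_ord a; have := ltn_ord b; lia.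
apply: (@Zcal_intro (W *m L *m W^T)).
- split=> [|a]; last by rewrite E Ld M1 sgsg.
  apply: Bplus_intro => [a b ba|a]; last by rewrite E Ld M1 sgsg oner_eq0.
  rewrite E Ls ?mulr0 ?mul0r //; last by rewrite -leqNgt ltnW.
  by rewrite -val_eqE /= gtn_eqF.
- by rewrite -mulmxA (mulmx1C WT) mulmx1.
- move=> a b ab lt; rewrite E; have [ba|ba] := ltnP a b;
    last by rewrite Ls ?mulr0 ?mul0r // -leqNgt.
  move/is_trig_mxP: Lt => -> ; rewrite ?mulr0 ?mul0r //.
  rewrite ltn_neqAle leqNgt lt andbT; apply: contra ab => /eqP/val_inj/perm_inj ->.
  exact: eqxx.
exists (u *m W *m u2) => //; exists (invmx (U *m u2)).
  by apply: Bplus_inv; case: Uu2.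
by rewrite bE mulmxK //; case: Uu2 => -[].
Qed.

(** The matrix relating the two lies in [B_+], and also in [B_-] as [invmx v' *m v], with unit
    diagonal. *)
Lemma Zcal_unique z z' : Zcal ns z -> Zcal ns z' ->
  left_coset z (Bplus F n) = left_coset z' (Bplus F n) -> z = z'.
Proof.
move=> /ZcalP[_ [v [vB v1] zE] _] /ZcalP[_ [v' [v'B v'1] zE'] _] /left_coset_eqP[c
  cB e].
have v'u : v' \in unitmx by case: v'B.
have Wu : W \in unitmx by rewrite signed_perm_unit.
have vc : v = v' *m c by apply: (can_inj (mulKmx Wu)); rewrite -zE e zE' mulmxA.
have cE : c = invmx v' *m v by rewrite vc mulKmx.
have cB' : Bminus F n c by rewrite cE; apply: Bminus_mul => //; apply: Bminus_inv.
suff c1 : c = 1%:M by rewrite e c1 mulmx1.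
apply/matrixP => a b; rewrite mxE; case: (ltngtP a b) => ab.
- by rewrite (Bminus0 cB') // -val_eqE /= ltn_eqF.
- by rewrite (Bplus0 cB) // -val_eqE /= gtn_eqF.
rewrite -(val_inj ab) eqxx.
by have := v1 a; rewrite vc trig_mul_diag ?v'1 ?mul1r //; [case: v'B | case: cB'].
Qed.

(** Split [z] in [B_- B_+] as a lower matrix [bh] times an upper unipotent one; the preimage is
    [t *m bh]. *)
Lemma psi_minus_surj (P : set 'M[F]_n) z (q : 'rV[F]_r) : Zcal ns z ->
    (forall j, q 0 j != 0) ->
  exists b, ZP ns b /\ psi_minus ns P b = (right_coset P z, q).
Proof.
move=> zZ q0; have /ZcalP[[u uU zE] _ [bm bmB [bp bpB zE']]] := zZ.
have [t [tW tq]] := torusWP_exists nsP q0.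
have tT : torus F n t by case: tW.
(* The diagonal of the upper factor is moved to the lower one. *)
pose s : 'M[F]_n := \matrix_(a, b) (bp a a *+ (a == b)).
have bpd a : bp a a != 0 by apply: Bplus_diag.
have sT : torus F n s.
  split; last by apply/is_diag_mxP => a b ab; rewrite mxE -val_eqE (negPf ab).
  suff [//] : Bminus F n s.
  apply: Bminus_intro => [a b ab|a]; rewrite mxE ?eqxx ?mulr1n //.
  by rewrite -val_eqE /= ltn_eqF.
have su : s \in unitmx by case: sT.
have tu : t \in unitmx by case: tT.
pose bh := bm *m s; pose u' := invmx s *m bp.
have bhB : Bminus F n bh by apply: Bminus_mul => //; apply: torus_Bminus.
have u'U : Uplus F n u'.
  have sB : Bplus F n s.
    apply: Bplus_intro => [a b ba|a]; rewrite mxE ?eqxx ?mulr1n //.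
    by rewrite -val_eqE /= gtn_eqF.
  split=> [|a]; first by apply: Bplus_mul => //; apply: Bplus_inv.
  have : (s *m u') a a = bp a a by rewrite /u' mulKVmx.
  rewrite diag_matrix_mul -[RHS]mulr1; exact: mulfI.
have zbh : z = bh *m u' by rewrite /bh /u' mulmxA mulmxK.
have u'u : u' \in unitmx by case: u'U => -[].
pose b := t *m bh.
have bE : b = t *m u *m invmx t *m t *m W *m invmx u'.
  by rewrite mulmxKV // -[t *m u *m W]mulmxA -zE zbh mulmxA mulmxK.
have tuU : Uplus F n (t *m u *m invmx t).
  have tiT : torus F n (invmx t).
    split; first by rewrite /GL /= unitmx_inv.
    have [d d0 tE] := torus_matrix tT.
    apply/is_diag_mxP => x y xy; case: (ltngtP x y) => lt.
    - by rewrite (Bminus0 (Bminus_inv (torus_Bminus tT))).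
    - rewrite (@Bplus0 _ _ _ x y (Bplus_inv _)) //; apply: Bplus_intro => [a a' aa'|a].
        by rewrite tE mxE -val_eqE /= gtn_eqF.
      by rewrite tE mxE eqxx mulr1n.
    by rewrite lt eqxx in xy.
  by have [] := torus_conj_Uplus tiT uU; rewrite invmxK.
have bZ : ZP ns b.
  split; first by apply: Bminus_mul => //; apply: torus_Bminus.
  exists (t *m u *m invmx t *m t *m W); last first.
    by exists (invmx u'); [apply: Uplus_inv | rewrite bE].
  exists (t *m u *m invmx t *m t); last by exists W; rewrite ?WE.
  by exists (t *m u *m invmx t) => //; exists t.
exists b; split=> //.
have [v1 [t' [v2 [fE v1U t'W v2U bE']]]] := ZP_factorisation bZ.
(* The factorisation chosen inside [psi_minus] may have other unipotent factors, but its torus part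
   is forced. *)
have t'E : t = t'.
  apply: (torus_unique tuU tT (Uplus_inv u'U) v1U _ v2U); first by case: t'W.
  by rewrite -bE -bE'.
rewrite /psi_minus fE -t'E tq; congr (right_coset P _, _).
rewrite (mulKmx tu).
have zc : left_coset z (Bplus F n) = left_coset bh (Bplus F n).
  have [u'B _] := u'U; by rewrite zbh (left_coset_Bplus _ u'B).
have [] := @xgetPex _ 0 [set z0 | Zcal ns z0 /\
  left_coset z0 (Bplus F n) = left_coset bh (Bplus F n)]%classic.
  by exists z.
by move=> z'Z z'c; apply: Zcal_unique => //; rewrite z'c zc.
Qed.

End Construction.

(** * The superpotential *)

Section Superdiagonal.
Variables (F : fieldType) (n : nat).
Implicit Types A B : 'M[F]_n.

Lemma ent_out m p (A : 'M[F]_(m, p)) i j : (p < j)%N -> ent A i j = 0.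
Proof.
move=> pj; rewrite /ent; case: insub => // a.
by rewrite insubF //; lia.
Qed.

Lemma super_Uplus_mul A B i : Uplus F n A -> Uplus F n B -> (0 < i)%N ->
  ent (A *m B) i i.+1 = ent A i i.+1 + ent B i i.+1.
Proof.
move=> [Au A1] [Bu B1] i0; have [i_n|ni] := ltnP i n; last by rewrite !ent_out // addr0.
have i1 : (i.-1 < n)%N by lia.
pose a := Ordinal i1; pose b := Ordinal i_n.
have ea : i = a.+1 by rewrite /= prednK.
have eb : i.+1 = b.+1 by [].
have ab : a != b by rewrite -val_eqE /=; lia.
rewrite !(ent_eq _ ea eb) mxE (bigD1 a) //= A1 mul1r (bigD1 b) 1?eq_sym //= B1 mulr1.
rewrite big1 ?addr0 1?addrC // => c /andP[ca cb].
have [lt|le] := ltnP c a; first by rewrite (Bplus0 Au) ?mul0r.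
rewrite (Bplus0 Bu) ?mulr0 //= ltn_neqAle eq_sym cb /= -(prednK i0) -[i.-1]/(val a).
by rewrite ltn_neqAle eq_sym ca.
Qed.

Lemma minor_Uplus A i : Uplus F n A -> (i <= n)%N ->
  minor (rowfun A) 0 i (segm n 1 i) = 1.
Proof.
move=> [Au A1]; elim: i => [|i IH] i_n.
  rewrite /= (_ : segm _ _ _ = finset.set0) ?eqxx //.
pose a := Ordinal i_n.
rewrite (@minor_last _ _ _ _ _ _ a); first last.
- move=> b; rewrite inE /= ltnS => bi ba.
  rewrite /rowfun add0n -[i.+1]/(a.+1) entE (Bplus0 Au) //.
  by rewrite ltn_neqAle -val_eqE /= in ba bi *; rewrite ba.
- by rewrite inE /= leqnn.
rewrite {1}/rowfun add0n -[i.+1]/(a.+1) entE A1 gt_card_segm //= subnn expr0 !mul1r.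
rewrite -[RHS](IH (ltnW i_n)); congr minor; apply/finset.setP => b.
by rewrite !inE -val_eqE /=; lia.
Qed.

Lemma minor_skip_Uplus A i : Uplus F n A -> (0 < i < n)%N ->
  minor (rowfun A) 0 i (skip n i) = ent A i i.+1.
Proof.
move=> AU; have [Au A1] := AU; case: i => // i /andP[_ i_n].
pose a := Ordinal i_n.
have ina : a \in skip n i.+1 by rewrite !inE /=; lia.
rewrite (@minor_last _ _ _ _ _ _ a) //; last first.
  move=> b; rewrite !inE -val_eqE /= => bS ba.
  have ai : (i < n)%N by lia.
  by rewrite /rowfun add0n -[i.+1]/((Ordinal ai).+1) entE (Bplus0 Au) //=; lia.
have := gt_card_skip (ltn0Sn i) i_n ina; rewrite /= eqxx -/(skip n i.+1) => g0.
have {g0} -> : gt_card a (skip n i.+1) = 0%N by lia.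
rewrite expr0 mul1r (_ : _ :\ a = segm n 1 i) ?minor_Uplus ?mulr1 //; first lia.
by apply/finset.setP => b; rewrite !inE -val_eqE /=; lia.
Qed.

(** The leading minors of [A] and of its inverse multiply to that of the identity. *)
Lemma plucker_segm_neq0 A i : A \in unitmx -> block_lower i A -> (i <= n)%N ->
  plucker A (segm n 1 i) != 0.
Proof.
move=> Au A0 i_n; have ci : #|segm n 1 i| = i by rewrite card_segm // subn1.
have U1 : Uplus F n 1%:M.
  by split=> [|a]; [apply: Bplus1 | rewrite mxE eqxx].
have := plucker_mul_block (invmx A) ci A0.
rewrite mulmxV // [plucker 1%:M _]pluckerE ci minor_Uplus // => e.
by apply/eqP => p0; move/eqP: e; rewrite p0 mul0r oner_eq0.
Qed.

End Superdiagonal.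

(** Comparing entries at the positions of the permutation shows that [y] has unit diagonal. A coset
    equality gives only an element of [B_+]; this makes it unipotent. *)
Lemma Uplus_signed_perm (F : fieldType) n s (w : 'S_n) (u u' y : 'M[F]_n) :
  Uplus F n u -> Uplus F n u' -> Bplus F n y ->
  u *m signed_perm F s w = u' *m signed_perm F s w *m y -> Uplus F n y.
Proof.
move=> uU u'U yB e; split=> // a.
have u'u : u' \in unitmx by case: u'U => -[].
have {}e : invmx u' *m u *m signed_perm F s w = signed_perm F s w *m y.
  by rewrite -mulmxA e -mulmxA mulKmx.
have := congr1 (fun A : 'M_n => A (w^-1 a)%g a) e.
rewrite signed_perm_mulE permKV -[X in _ X = _](permKV w) mul_signed_permE.
have [_ ->] := Uplus_mul (Uplus_inv u'U) uU.
by rewrite mulrC => /mulfI <-; rewrite ?signr_eq0.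
Qed.

(** * Evaluation of both sides on a representative *)

Section Computation.
Variables (F : fieldType) (n : nat) (ns : seq nat).
Hypothesis nsP : is_IP n ns.
Notation N := (nn n ns).
Notation r := (size ns).
Notation blk := (block_of n ns).
Notation hat := (pivot_col n ns).
Notation sigma := (pivot_perm n ns).
Notation W := (signed_perm F (fun a : 'I_n => nn n ns (block_of n ns a))
  (pivot_perm n ns)).

Variables (u v z : 'M[F]_n).
Hypothesis uU : Uplus F n u.
Hypothesis vU : Uminus F n v.
Hypothesis zu : z = u *m W.
Hypothesis zv : z = W *m v.

Lemma z_uE (a b : 'I_n) : z a (sigma b) = u a b * (-1) ^+ N (blk b).
Proof. by rewrite zu mul_signed_permE. Qed.

Lemma z_vE (a b : 'I_n) : z a b = (-1) ^+ N (blk a) * v (sigma a) b.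
Proof. by rewrite zv signed_perm_mulE. Qed.

Lemma z_right (a b : 'I_n) : (hat a < b)%N -> z a b = 0.
Proof.
by move=> ab; rewrite z_vE; case: vU => vB _; rewrite (Bminus0 vB) ?mulr0 // sigmaE.
Qed.

Lemma z_hat (a : 'I_n) : z a (sigma a) = (-1) ^+ N (blk a).
Proof. by rewrite z_uE; case: uU => _ ->; rewrite mul1r. Qed.

Lemma z_below (a a' : 'I_n) : (a < a')%N -> z a' (sigma a) = 0.
Proof. by move=> aa'; rewrite z_uE; case: uU => uB _; rewrite (Bplus0 uB) // mul0r. Qed.

(** Such an entry appears in [z] to the right of a pivot. Thus the superdiagonal of [u] is zero
    except at block boundaries. *)
Lemma u_same_block (a b : 'I_n) : (a < b)%N -> blk a = blk b -> u a b = 0.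
Proof.
move=> ab e; have : z a (sigma b) = 0.
  by apply: z_right; rewrite sigmaE // hat_ltn_blk.
by rewrite z_uE => /eqP; rewrite mulf_eq0 signr_eq0 orbF => /eqP.
Qed.

Variables (bh c : 'M[F]_n).
Hypothesis bhB : Bminus F n bh.
Hypothesis cU : Uplus F n c.
Hypothesis zbh : z = bh *m c.

Lemma plucker_zE i (K : {set 'I_n}) : #|K| = i ->
  plucker z K = plucker bh (segm n 1 i) * plucker c K.
Proof.
move=> cK; rewrite zbh; apply: plucker_mul_block => //.
by case: bhB => _ /trig_blockP bt; apply: bt.
Qed.

Lemma plucker_bh i : (i <= n)%N -> plucker bh (segm n 1 i) != 0.
Proof. by move=> i_n; case: bhB => bu /trig_blockP bt; apply: plucker_segm_neq0. Qed.

Lemma minor_z i : (i <= n)%N -> minor (rowfun z) 0 i (segm n 1 i) != 0.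
Proof.
move=> i_n; have ci : #|segm n 1 i| = i by rewrite card_segm // subn1.
rewrite -{1}ci -pluckerE (plucker_zE ci) [plucker c _]pluckerE ci.
by rewrite minor_Uplus // mulr1 plucker_bh.
Qed.

Lemma ratio_z i : (0 < i < n)%N -> ratio (rowfun z) i = ent c i i.+1.
Proof.
move=> i_n; have i_n' : (i <= n)%N by lia.
have ci : #|segm n 1 i| = i by rewrite card_segm // subn1.
have cs : #|skip n i| = i by rewrite card_skip //; lia.
rewrite /ratio -{1}cs -{3}ci -!pluckerE (plucker_zE ci) (plucker_zE cs) -mulf_div.
rewrite divff ?plucker_bh // mul1r !pluckerE ci cs minor_Uplus // divr1.
exact: minor_skip_Uplus.
Qed.

Lemma plucker_formula_z (P : set 'M[F]_n) (g : 'M[F]_n) (q : 'rV[F]_r) :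
    is_parabolic ns P -> right_coset P z g ->
  denominators_neq0 ns g /\
  plucker_formula g q = \sum_(1 <= i < n) ent c i i.+1 -
    \sum_(1 <= j < r.+1) ent q 1 j * ent u (N j) (N j).+1.
Proof.
move=> [PG BP Ps] /right_cosetP[p Pp gE].
have pbl j : (0 < j <= r)%N -> block_lower (N j) p.
  move=> jr; have jn : (0 < N j < n)%N.
    have := @nn_ltn _ _ nsP 0 j; have := @nn_lt_n _ _ nsP j.
    by rewrite -[N 0]/0%N; lia.
  apply: (parabolic_block_lower PG BP jn) Pp.
  have inns : N j \in ns by apply/(mem_nn n ns); exists j.
  by move/(Ps _ jn); rewrite mem_filter inns.
have pu : p \in unitmx by case: PG => + _ _ _; apply.
pose lam j := plucker p (segm n 1 (N j)).
have [||||||dn ->] := @plucker_formula_hat F n ns nsP (rowfun z) _ _ _ _ g lam _ _ q.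
- move=> a b an; rewrite /rowfun -[a.+1]/((Ordinal an).+1) entE;
    exact: (@z_right (Ordinal an)).
- move=> a b an bE; rewrite /rowfun -[a.+1]/((Ordinal an).+1) entE.
  have -> : b = sigma (Ordinal an) by apply: val_inj; rewrite /= sigmaE.
  by rewrite z_hat.
- move=> a a' b aa' an bE; rewrite /rowfun -[a'.+1]/((Ordinal an).+1) entE.
  have an0 := ltn_trans aa' an.
  have -> : b = sigma (Ordinal an0) by apply: val_inj; rewrite /= sigmaE.
  exact: z_below.
- exact: minor_z.
- move=> j K jr cK; rewrite gE (plucker_mul_block _ cK (pbl j jr)) [plucker z
    K]pluckerE cK //.
- move=> j jr; apply: plucker_segm_neq0 => //; first exact: pbl.
  by apply: (nn_le_n nsP); lia.
split=> //; congr (_ - _).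
  by rewrite big_nat [RHS]big_nat; apply: eq_bigr => i i_n; apply: ratio_z.
rewrite big_nat [RHS]big_nat; apply: eq_bigr => j jr; congr (_ * _).
have jn : (N j < n)%N by apply: (nn_lt_n nsP); lia.
have j0 : (0 < N j)%N by have := @nn_ltn _ _ nsP 0 j; rewrite -[N 0]/0%N; lia.
have j1 : ((N j).-1 < n)%N by lia.
pose x := Ordinal j1; pose y := Ordinal jn.
have jb : (N j <= y < N j.+1)%N by rewrite /= leqnn (nn_ltn nsP) //; lia.
have jr' : (j <= r)%N by lia.
have ys : sigma y = (n - N j.+1)%N :> nat.
  by rewrite sigmaE // (hatE nsP jr' jb) /= subnn addn0.
(* Column [n - N j.+1] is the pivot of row [N j], so the entry of [z] is that of [u] times
   [(-1)^N j], which cancels the sign of [term_q]. *)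
rewrite -ys valK /rowfun -[(N j).-1.+1]/(x.+1) entE z_uE (blk_unique nsP jr' jb).
rewrite mulrC -mulrA -expr2 sqrr_sign mulr1.
by rewrite (@ent_eq _ _ _ u x y) //= prednK.
Qed.

Variables (u1 t u2 : 'M[F]_n).
Hypothesis u1U : Uplus F n u1.
Hypothesis tW : torusWP ns t.
Hypothesis u2U : Uplus F n u2.
Hypothesis bhE : bh = invmx t *m (u1 *m t *m W *m u2).

Lemma FLie_sum :
  \sum_(1 <= i < n) (ent u1 i i.+1 + ent u2 i i.+1) =
  \sum_(1 <= j < r.+1) ent (qcoord ns t) 1 j * ent u (N j) (N j).+1
  - \sum_(1 <= i < n) ent c i i.+1.
Proof.
have tT : torus F n t by case: tW.
have [u1'U u1'E] := torus_conj_Uplus tT u1U.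
set u1' := invmx t *m u1 *m t in u1'U u1'E.
have WT : W *m W^T = 1%:M := signed_perm_mulT _ _ _.
have Wu : W \in unitmx by rewrite signed_perm_unit.
(* Measures how far the chosen [u2] is from the inverse of [c]; it is the identity only for a
   particular factorisation. *)
pose y := u2 *m c; have yU : Uplus F n y by apply: Uplus_mul.
pose Y := W *m y *m W^T.
have YE a b : Y a b = (-1) ^+ N (blk a) * y (sigma a) (sigma b) * (-1) ^+ N (blk b).
  exact: signed_perm_conjE.
have uE : u = u1' *m Y.
  apply: (can_inj (mulmxK Wu)); rewrite -zu zbh bhE /Y /y /u1'.
  by rewrite -!mulmxA (mulmx1C WT) mulmx1.
have YU : Uplus F n Y.
  have u1'u : u1' \in unitmx by case: u1'U => -[].
  have -> : Y = invmx u1' *m u by rewrite uE mulKmx.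
  by apply: Uplus_mul => //; apply: Uplus_inv.
have yr i : (0 < i)%N -> ent u2 i i.+1 = ent y i i.+1 - ent c i i.+1.
  by move=> i0; rewrite super_Uplus_mul // addrK.
have ur i : (0 < i)%N -> ent u i i.+1 = ent u1' i i.+1 + ent Y i i.+1.
  by move=> i0; rewrite uE super_Uplus_mul.
(* Pairs each superdiagonal entry of [u1] with the one of [y] in the pivot row. Summing up to [n]
   lets the permutation [sigma] reindex the whole sum; entries out of range are zero. *)
pose f i := if insub i.-1 is Some a then
  ent u1 i i.+1 + ent y (sigma a).+1 (sigma a).+2 else 0.
have sumf : \sum_(1 <= i < n.+1) f i =
    \sum_(1 <= i < n) ent u1 i i.+1 + \sum_(1 <= i < n) ent y i i.+1.
  have ext (A : 'M[F]_n) : \sum_(1 <= i < n) ent A i i.+1 = \sum_(a < n) ent A a.+1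
    a.+2.
    rewrite -(big_mkord xpredT (fun a => ent A a.+1 a.+2)).
    rewrite -(big_add1 _ _ 0 n.+1 xpredT (fun i => ent A i i.+1)).
    have n0 : (0 < n)%N := nn_lt_n nsP (leq0n r).
    by rewrite big_nat_recr //= [ent A n _]ent_out ?addr0.
  rewrite !ext [X in _ + X](reindex_inj (@perm_inj _ sigma)) /= -big_split /=.
  rewrite (big_add1 _ _ 0 n.+1) big_mkord; apply: eq_bigr => a _.
  by rewrite /f /= valK.
(* Inside a block [t] is constant and [sigma] preserves adjacency, so the pair adds up to a
   superdiagonal entry of [u], which vanishes by [u_same_block]. *)
have f_same (a b : 'I_n) : b = a.+1 :> nat -> blk a = blk b -> f b = 0.
  move=> ba e; have [ea eb] : (a.+1 = a.+1 /\ a.+2 = b.+1)%N by rewrite ba.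
  have ab : (a < b)%N by rewrite ba.
  have sba : sigma b = (sigma a).+1 :> nat.
    rewrite !sigmaE // /pivot_col -e ba subSn ?addnS //.
    by case: (blkP ns (ltn_ord a)) => _ /andP[].
  have := ur a.+1 isT; rewrite /f ba /= valK !(ent_eq _ ea eb) (u_same_block ab e).
  rewrite (@ent_eq _ _ _ y (sigma a) (sigma b)) ?sba // YE -e mulrAC -expr2
    sqrr_sign mul1r.
  rewrite u1'E (torusWP_blk nsP tW ba e) mulrAC mulVf ?mul1r //.
  exact: Bminus_diag (torus_Bminus tT).
(* After the last pivot of a block comes the first pivot of the previous block, which belongs to a
   higher row, so the entry corresponds to one of [Y] below the diagonal. For the first block it is
   out of range. *)
have y_last (a : 'I_n) : a.+1 = N (blk a).+1 -> ent y (sigma a).+1 (sigma a).+2 = 0.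
  move=> aN; have [br /andP[b1 b2]] := blkP ns (ltn_ord a).
  have nk := @nn_le_n _ _ nsP (blk a).+1 br.
  have [k0|k0] := posnP (blk a).
    by rewrite ent_out // sigmaE // /pivot_col k0 -[N 0]/0%N -k0 -aN; have :=
      ltn_ord a; lia.
  have kn : (N (blk a).-1 < n)%N by apply: (nn_lt_n nsP); lia.
  have kb : (N (blk a).-1 <= Ordinal kn < N (blk a).-1.+1)%N.
    by rewrite leqnn /=; apply: (nn_ltn nsP); lia.
  pose a' := Ordinal kn; have a'a : (a' < a)%N by move: kb; rewrite prednK //=; lia.
  have kr : ((blk a).-1 <= r)%N by lia.
  have sa' : (sigma a).+2 = (sigma a').+1.
    rewrite !sigmaE // (hatE nsP kr kb) prednK //= subnn /pivot_col; lia.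
  have := YE a a'; rewrite (Bplus0 _ a'a); last by case: YU.
  rewrite (ent_eq _ erefl sa') => /esym/eqP.
  by rewrite !mulf_eq0 !signr_eq0 orbF => /eqP.
(* At a boundary [sigma] reverses the two rows, so [Y] contributes nothing to [u], and conjugation
   by [t] supplies the factor q. *)
have f_last j : (0 < j <= r)%N ->
    f (N j) = ent (qcoord ns t) 1 j * ent u (N j) (N j).+1.
  move=> jr; have jr' : (j <= r)%N by lia.
  have jn : (N j < n)%N by apply: (nn_lt_n nsP).
  have j1 : (N j.-1 < N j)%N by apply: (nn_ltn nsP); lia.
  have xn : ((N j).-1 < n)%N by lia.
  pose a := Ordinal xn; pose b := Ordinal jn.
  have ea : N j = a.+1 by rewrite /=; lia.
  have eb : (N j).+1 = b.+1 by [].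
  have jr1 : (j.-1 <= r)%N by lia.
  have ab : (N j.-1 <= a < N j.-1.+1)%N by rewrite prednK /=; lia.
  have bb : (N j <= b < N j.+1)%N by rewrite /= leqnn (nn_ltn nsP).
  have ka := blk_unique nsP jr1 ab; have kb := blk_unique nsP jr' bb.
  rewrite /f -[(N j).-1]/(val a) valK y_last ?ka ?prednK //; try lia.
  rewrite addr0 (ur _ (leq_ltn_trans (leq0n _) j1)) !(ent_eq _ ea eb) YE.
  have -> : y (sigma a) (sigma b) = 0.
    case: yU => yB _; rewrite (Bplus0 yB) // !sigmaE // hat_lt_blk // ka kb.
    by lia.
  rewrite mulr0 mul0r addr0 u1'E (@qcoordE _ _ _ nsP t j a b) //=.
  by field; rewrite !(Bminus_diag _ (torus_Bminus tT)).
have f_n : f n = 0.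
  have n0 : (0 < n)%N := nn_lt_n nsP (leq0n r).
  have xn : (n.-1 < n)%N by lia.
  have rb : (N r <= n.-1 < N r.+1)%N by rewrite nnS_last; have :=
    nn_lt_n nsP (leqnn r); lia.
  rewrite /f -[n.-1]/(val (Ordinal xn)) valK ent_out // y_last ?addr0 //=.
  by rewrite (blk_unique nsP (leqnn r) rb) nnS_last prednK.
have f_in j i : (j <= r)%N -> (N j < i < N j.+1)%N -> f i = 0.
  move=> jr ji; have nj := @nn_le_n _ _ nsP j.+1 jr.
  have an : (i.-1 < n)%N by lia.
  have bn : (i < n)%N by lia.
  apply: (@f_same (Ordinal an) (Ordinal bn)) => /=; first by lia.
  by rewrite !(@blk_unique _ _ nsP _ j) //; lia.
have sums : \sum_(1 <= i < n.+1) f i =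
    \sum_(1 <= j < r.+1) ent (qcoord ns t) 1 j * ent u (N j) (N j).+1.
  have n0 : (0 < n)%N := nn_lt_n nsP (leq0n r).
  have z0 j : (j <= r)%N -> \sum_((N j).+1 <= i < N j.+1) f i = 0.
    by move=> jr; rewrite big_nat big1 // => i ji; apply: (@f_in j).
  rewrite big_nat_recr // f_n -[X in \sum_(1 <= i < X) f i](nnS_last n ns).
  rewrite (sum_blocks nsP f (leqnn r)) (z0 0%N) // add0r.
  rewrite /= addr0 (_ : \sum_(1 <= j < r.+1) \sum_(_ <= i < _) f i = 0) ?add0r;
    last first.
    by rewrite big_nat big1 // => j jr; rewrite z0 //; lia.
  rewrite big_nat [RHS]big_nat; apply: eq_bigr => j jr.
  by apply: f_last; lia.
rewrite -sums sumf big_split /= -addrA; congr (_ + _); rewrite -sumrB.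
by rewrite big_nat [RHS]big_nat; apply: eq_bigr => i i0; apply: yr; lia.
Qed.

End Computation.

Lemma F_minus_plucker (F : fieldType) (n : nat) (ns : seq nat)
    (P X : set 'M[F]_n) (g : 'M[F]_n) (q : 'rV[F]_(size ns)) :
  is_IP n ns -> is_parabolic ns P -> PGcirc ns P X -> (forall j, q 0 j != 0) ->
  X = right_coset P g ->
  denominators_neq0 ns g /\ F_minus P (X, q) = plucker_formula g q.
Proof.
move=> nsP PP Xc q0 Xg; have [PG BP _] := PP.
have [z0 z0Z Xz0] := Zcal_of_PGcirc nsP PG BP Xc.
have [bZ bpsi] : ZP ns (psi_minus_inv P (X, q)) /\
    psi_minus ns P (psi_minus_inv P (X, q)) = (X, q).
  apply: (@xgetPex _ 0 [set b | ZP ns b /\ psi_minus ns P b = (X, q)]%classic).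
  by rewrite Xz0; apply: psi_minus_surj.
rewrite /F_minus; set b := psi_minus_inv P (X, q) in bZ bpsi *.
have [u1 [t [u2 [fE u1U tW u2U bE]]]] := ZP_factorisation nsP bZ.
have tT : torus F n t by case: tW.
move: bpsi; rewrite /psi_minus fE /FLie fE.
set bh := invmx t *m b; set z := xget _ _ => -[Xz qE].
have bhB : Bminus F n bh.
  by apply: Bminus_mul; [apply/Bminus_inv/torus_Bminus | case: bZ].
have [u1'U _] := torus_conj_Uplus tT u1U.
have tu : t \in unitmx by case: tT.
have [zZ zbh] : Zcal ns z /\ left_coset z (Bplus F n) = left_coset bh (Bplus F n).
  apply: (@xgetPex _ 0 [set z | Zcal ns z /\
    left_coset z (Bplus F n) = left_coset bh (Bplus F n)]%classic).
  move: bhB; rewrite /bh bE !mulmxA => bhB.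
  by have [z' z'Z z'E] := Zcal_exists nsP u1'U u2U bhB; exists z'.
have /(ZcalP nsP)[[u uU zu] [v vU zv] _] := zZ.
have [c cB zc] := left_coset_eqP zbh.
pose eps (a : 'I_n) := nn n ns (block_of n ns a); pose sgm := pivot_perm n ns.
(* The equality [u W = u1' W (u2 c)] makes [u2 c] unipotent, hence also [c]. *)
have cU : Uplus F n c.
  have u2B : Bplus F n u2 by case: u2U.
  have [_ y1] : Uplus F n (u2 *m c).
    apply: (@Uplus_signed_perm _ _ eps sgm _ _ _ uU u1'U (Bplus_mul u2B cB)).
    by rewrite -[LHS]zu zc /bh [in LHS]bE !mulmxA.
  split=> // a; have := y1 a.
  by rewrite Bplus_mul_diag //; case: u2U => _ ->; rewrite mul1r.
have Pg : right_coset P z g by rewrite Xz Xg; apply: right_coset_self.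
have bhE : bh = invmx t *m (u1 *m t *m signed_perm F eps sgm *m u2) :=
  congr1 (mulmx (invmx t)) bE.
have [dn ->] := plucker_formula_z nsP uU vU zu zv bhB cU zc q PP Pg; split=> //.
rewrite (FLie_sum nsP uU vU zu zv cU zc u1U tW u2U bhE).
by rewrite qE opprB.
Qed.

Theorem theorem3p18 (R : realType) (n : nat) (ns : seq nat)
    (P : set 'M[R[i]]_n) (X : set 'M[R[i]]_n) (g : 'M[R[i]]_n)
    (q : 'rV[R[i]]_(size ns)) :
  (2 <= n)%N ->
  is_IP n ns ->
  is_parabolic ns P ->
  PGcirc ns P X ->
  (forall j, q 0 j != 0) ->
  GL R[i] n g ->
  X = right_coset P g ->
  denominators_neq0 ns g /\
  F_minus P (X, q) = plucker_formula g q.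
Proof. by move=> _ nsP PP Xc q0 _ Xg; apply: F_minus_plucker. Qed.
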